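(* Let $n\ge2$ and $\tau>0$. The set of initial data $u^0\in L^2_\sigma$ for which there exists an admissible solution $u\in L^\infty_tL^2_{\sigma,x}$, with $\operatorname{supp}(u)\subset\mathbb{R}^n\times[0,\tau]$, of the Cauchy problem for the incompressible Euler equations in $\mathbb{R}^n\times[0,\infty)$, $$\partial_tu+u\cdot\nabla u-\nabla P=0,\qquad\operatorname{div}u=0,\qquad u(\cdot,0)=u^0,$$ is nowhere dense in $L^2_\sigma$.
   Context: $L^2_\sigma=\{v\in L^2(\mathbb{R}^n,\mathbb{R}^n):\operatorname{div}v=0\}$ with the $L^2$ norm; $L^\infty_tL^2_{\sigma,x}$ is the space of fields in $L^\infty((0,\infty);L^2(\mathbb{R}^n,\mathbb{R}^n))$ that are divergence-free in $x$. Given $u^0\in L^2_\sigma$, $u\in L^\infty_tL^2_{\sigma,x}$ is a weak solution of the Cauchy problem if $$\int_0^\infty\int_{\mathbb{R}^n}(u\cdot\partial_t\varphi+u\otimes u:\mathrm{D}\varphi)\,dx\,dt+\int_{\mathbb{R}^n}u^0\cdot\varphi(\cdot,0)\,dx=0$$ for all $\varphi\in C_c^\infty(\mathbb{R}^n\times[0,\infty),\mathbb{R}^n)$ with $\operatorname{div}_x\varphi=0$. A weak solution is admissible if it satisfies the energy inequality $\int_{\mathbb{R}^n}|u(x,t)|^2\,dx\le\int_{\mathbb{R}^n}|u^0(x)|^2\,dx$ for all $t\ge0$. *)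

(* Defs.v *)
From HB Require Import structures.
From mathcomp Require Import all_boot all_order all_algebra.
From mathcomp Require Import all_classical all_reals all_analysis.
From mathcomp Require Import measurable_realfun ring lra.

Set Implicit Arguments.
Unset Strict Implicit.
Unset Printing Implicit Defensive.
Import Order.TTheory GRing.Theory Num.Theory.
Import numFieldNormedType.Exports.

Local Open Scope classical_set_scope.
Local Open Scope ring_scope.

(* Points of R^n are row vectors.  Their sigma-algebra is the one generated by
   the coordinates (the same construction as the library's for n.-tuple T);
   over the reals it is the Borel sigma-algebra. *)
Section measurable_rV.
Context {d} {T : measurableType d}.
Variable n : nat.

Let coors : 'I_n -> 'rV[T]_n -> T := fun i x => x ord0 i.

Let rV_set0 : g_sigma_preimage coors set0.
Proof. exact: sigma_algebra0. Qed.

Let rV_setC A : g_sigma_preimage coors A -> g_sigma_preimage coors (~` A).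
Proof. exact: sigma_algebraC. Qed.

Let rV_bigcup (F : _^nat) : (forall i, g_sigma_preimage coors (F i)) ->
  g_sigma_preimage coors (\bigcup_i (F i)).
Proof. exact: sigma_algebra_bigcup. Qed.

HB.instance Definition _ := @isMeasurable.Build (measure_tuple_display d)
  'rV[T]_n (g_sigma_preimage coors) rV_set0 rV_setC rV_bigcup.

Lemma measurable_coord (i : 'I_n) :
  measurable_fun [set: 'rV[T]_n] (fun x : 'rV[T]_n => x ord0 i).
Proof.
move=> _ Y mY; rewrite setTI; apply: sub_sigma_algebra => /=.
rewrite -bigcup_seq/=; exists i => /=; first by rewrite mem_index_enum.
by exists Y => //; rewrite setTI.
Qed.

Lemma measurable_fun_rVP d' (U : measurableType d') (f : U -> 'rV[T]_n) :
  measurable_fun [set: U] f <->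
  forall i, measurable_fun [set: U] (fun x => f x ord0 i).
Proof.
split=> [mf i|mf].
  exact: (measurableT_comp (measurable_coord i) mf).
apply: (@measurability _ _ _ _ _ _
  (\big[setU/set0]_(i < n) preimage_set_system setT (coors i) measurable)).
  by [].
move=> _ [B + <-]; rewrite -bigcup_seq/= => -[i _ [C mC <-]].
by rewrite !setTI; have := mf i measurableT _ mC; rewrite setTI.
Qed.

End measurable_rV.

Section lebesgue_rV.
Context {R : realType}.

Definition consrV n (p : measurableTypeR R * 'rV[R]_n) : 'rV[R]_n.+1 :=
  row_mx (\row_(_ < 1) p.1) p.2.

Lemma measurable_consrV n : measurable_fun setT (@consrV n).
Proof.
apply/measurable_fun_rVP => i; rewrite /consrV.
case: (@split_ordP 1 n i) => j ->.
  under eq_fun do rewrite (@row_mxEl _ 1 1 n) mxE.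
  exact: measurable_fst.
under eq_fun do rewrite (@row_mxEr _ 1 1 n).
exact: (measurableT_comp (measurable_coord j) measurable_snd).
Qed.

Section step.
Variables (n : nat) (mu : {sigma_finite_measure set 'rV[R]_n -> \bar R}).

Definition lebesgue_step := pushforward (lebesgue_measure \x mu)%E (@consrV n).

Let lebesgue_step0 : lebesgue_step set0 = 0%E.
Proof. by rewrite /lebesgue_step /pushforward preimage_set0 measure0. Qed.

Let lebesgue_step_ge0 A : (0 <= lebesgue_step A)%E.
Proof. by rewrite /lebesgue_step /pushforward measure_ge0. Qed.

Let lebesgue_step_sigma_additive : semi_sigma_additive lebesgue_step.
Proof.
move=> F mF tF mUF; rewrite /lebesgue_step /pushforward preimage_bigcup.
have mpre A : measurable A -> measurable (@consrV n @^-1` A).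
  by move=> mA; have := @measurable_consrV n measurableT _ mA; rewrite setTI.
apply: measure_semi_sigma_additive => [k||]; first exact: mpre.
- apply/trivIsetP => i j _ _ ij; rewrite -preimage_setI.
  by move/trivIsetP : tF => /(_ _ _ _ _ ij) ->//; rewrite preimage_set0.
- by rewrite -preimage_bigcup; exact: mpre.
Qed.

HB.instance Definition _ := isMeasure.Build _ _ _ lebesgue_step
  lebesgue_step0 lebesgue_step_ge0 lebesgue_step_sigma_additive.

Let lebesgue_step_sigma_finite : sigma_finite setT lebesgue_step.
Proof.
have /sigma_finiteP[F [FT ndF Foo]] := sigma_finiteT (@lebesgue_measure R).
have /sigma_finiteP[G [GT ndG Goo]] := sigma_finiteT mu.
pose g (x : 'rV[R]_n.+1) : measurableTypeR R * 'rV[R]_n :=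
  (x ord0 ord0, rsubmx (x : 'rV[R]_(1 + n))).
have gK p : g (consrV p) = p.
  case: p => a v; rewrite /g /consrV row_mxKr; congr pair.
  have -> : (ord0 : 'I_n.+1) = @lshift 1 n ord0 by exact: val_inj.
  by rewrite (@row_mxEl _ 1 1 n) mxE.
have mg : measurable_fun setT g.
  apply/measurable_fun_pairP; split.
    exact: (@measurable_coord _ (measurableTypeR R) n.+1 ord0).
  apply/measurable_fun_rVP => i; rewrite /g /=.
  under eq_fun do rewrite mxE.
  exact: (@measurable_coord _ R n.+1 (@rshift 1 n i)).
exists (fun k => g @^-1` (F k `*` G k)).
  apply/esym; rewrite -preimage_bigcup -[RHS](preimage_setT g); congr (_ @^-1` _).
  rewrite -setXTT FT GT predeqE => -[x y]; split.
    by move=> [k _ []/= ? ?]; split; exists k.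
  move=> [/= [k _ Fx] [l _ Gy]]; exists (maxn k l) => //; split.
  - by move: x Fx; exact/subsetPset/ndF/leq_maxl.
  - by move: y Gy; exact/subsetPset/ndG/leq_maxr.
move=> k; have [mFk Fkoo] := Foo k; have [mGk Gkoo] := Goo k.
have mFG : measurable (F k `*` G k) by exact: measurableX.
split; first by have := mg measurableT _ mFG; rewrite setTI.
rewrite /lebesgue_step /pushforward -comp_preimage.
rewrite (_ : g \o _ = id) ?preimage_id; last first.
  by apply/funext => p /=; rewrite gK.
by rewrite /= product_measure1E// lte_mul_pinfty// ge0_fin_numE.
Qed.

HB.instance Definition _ := Measure_isSigmaFinite.Build _ _ _
  lebesgue_step lebesgue_step_sigma_finite.

End step.

Fixpoint lebesgue_rV (n : nat) : {sigma_finite_measure set 'rV[R]_n -> \bar R} :=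
  match n with
  | 0%N => dirac (0 : 'rV[R]_0)
  | m.+1 => lebesgue_step (lebesgue_rV m)
  end.

Lemma lebesgue_rV_box n (a b : 'rV[R]_n) :
  (forall i, a ord0 i <= b ord0 i) ->
  lebesgue_rV n [set x | forall i, x ord0 i \in `[a ord0 i, b ord0 i]] =
  (\prod_(i < n) (b ord0 i - a ord0 i))%:E.
Proof.
elim: n a b => [|n IHn] a b ab /=.
  rewrite big_ord0 diracE mem_set//= => i; by case: i.
pose tl (c : 'rV[R]_n.+1) : 'rV[R]_n := \row_i c ord0 (lift ord0 i).
have cons0 p : @consrV n p ord0 ord0 = p.1.
  have -> : (ord0 : 'I_n.+1) = @lshift 1 n ord0 by exact: val_inj.
  by rewrite /consrV (@row_mxEl _ 1 1 n) mxE.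
have consS p i : @consrV n p ord0 (lift ord0 i) = p.2 ord0 i.
  have -> : lift ord0 i = @rshift 1 n i by exact: val_inj.
  by rewrite /consrV (@row_mxEr _ 1 1 n).
rewrite /lebesgue_step /pushforward.
set S := [set x : 'rV[R]_n | forall i,
  x ord0 i \in `[tl a ord0 i, tl b ord0 i]].
have -> : @consrV n @^-1`
    [set x | forall i, x ord0 i \in `[a ord0 i, b ord0 i]] =
    [set` `[a ord0 ord0, b ord0 ord0]] `*` S.
  rewrite predeqE => -[x y]; split => /=.
    move=> h; split=> [|i] /=; first by have := h ord0; rewrite cons0.
    by have := h (lift ord0 i); rewrite consS !mxE.
  move=> [/= h0 hS] i; case: (unliftP ord0 i) => [j ->|->].
    by rewrite consS; have := hS j; rewrite !mxE.
  by rewrite cons0.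
have mS : measurable S.
  rewrite (_ : S = \bigcap_(i in [set: 'I_n])
      ((fun x : 'rV[R]_n => x ord0 i) @^-1`
        [set` `[tl a ord0 i, tl b ord0 i]])); last first.
    by rewrite predeqE => x; split => [h i _|h i]; exact: h.
  apply: fin_bigcap_measurable => // i _; rewrite -[X in measurable X]setTI.
  exact: (@measurable_coord _ R n i).
rewrite product_measure1E//= IHn; last by move=> i; rewrite !mxE.
rewrite lebesgue_measure_itv/= lte_fin.
rewrite big_ord_recl EFinM; congr (_ * _)%E; last first.
  by congr EFin; apply: eq_bigr => i _; rewrite !mxE.
have := ab ord0; rewrite le_eqVlt => /predU1P[->|->]; last by rewrite EFinB.
by rewrite ltxx subrr.
Qed.
End lebesgue_rV.
Arguments lebesgue_rV {R} n.

(* Euclidean norm; the library's norm on matrices is the sup norm. *)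
Definition enorm {R : realType} n (x : 'rV[R]_n) : R :=
  Num.sqrt (\sum_(i < n) x ord0 i ^+ 2).

Section enorm_theory.
Context {R : realType} (n : nat).
Implicit Types x y : 'rV[R]_n.

Lemma enorm_ge0 x : 0 <= enorm x.
Proof. exact: sqrtr_ge0. Qed.

Lemma enorm_sqr x : enorm x ^+ 2 = \sum_(i < n) x ord0 i ^+ 2.
Proof. by rewrite sqr_sqrtr// sumr_ge0// => i _; exact: sqr_ge0. Qed.

Lemma enormN x : enorm (- x) = enorm x.
Proof. by congr Num.sqrt; apply: eq_bigr => i _; rewrite mxE sqrrN. Qed.

Lemma enorm_eq0 x : enorm x = 0 -> x = 0.
Proof.
move=> x0; apply/rowP => i; rewrite mxE; apply/eqP; rewrite -sqrf_eq0.
have /eqP : \sum_(i < n) x ord0 i ^+ 2 = 0 by rewrite -enorm_sqr x0 expr0n.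
rewrite psumr_eq0; last by move=> j _; exact: sqr_ge0.
by move=> /allP /(_ i); rewrite mem_index_enum => /(_ isT).
Qed.

Lemma enorm_triangle x y : enorm (x + y) <= enorm x + enorm y.
Proof.
have [dot dotE] : exists dot, dot = \sum_(i < n) x ord0 i * y ord0 i.
  by eexists.
have dot_le : dot <= enorm x * enorm y.
  have [x0|x0] := eqVneq (enorm x) 0.
    rewrite x0 mul0r dotE big1// => i _.
    by rewrite (enorm_eq0 x0) mxE mul0r.
  have xgt0 : 0 < enorm x ^+ 2 by rewrite exprn_gt0// lt0r x0 enorm_ge0.
  apply: le_trans (ler_norm _) _.
  rewrite -(ler_pXn2r (ltn0Sn 1)) ?nnegrE ?mulr_ge0 ?enorm_ge0//.
  rewrite real_normK ?num_real// exprMn -subr_ge0 -(pmulr_rge0 _ xgt0).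
  have -> : enorm x ^+ 2 * (enorm x ^+ 2 * enorm y ^+ 2 - dot ^+ 2) =
      \sum_(i < n) (enorm x ^+ 2 * y ord0 i - dot * x ord0 i) ^+ 2.
    transitivity (enorm x ^+ 4 * (\sum_(i < n) y ord0 i ^+ 2)
      - 2 * enorm x ^+ 2 * dot * (\sum_(i < n) x ord0 i * y ord0 i)
      + dot ^+ 2 * (\sum_(i < n) x ord0 i ^+ 2)).
      by rewrite -!enorm_sqr -dotE; ring.
    rewrite !mulr_sumr -sumrB -big_split; apply: eq_bigr => i _ /=. ring.
  by apply: sumr_ge0 => i _; exact: sqr_ge0.
rewrite -(ler_pXn2r (ltn0Sn 1)) ?nnegrE ?addr_ge0 ?enorm_ge0//.
rewrite sqrrD !enorm_sqr.
have -> : \sum_(i < n) (x + y) ord0 i ^+ 2 = \sum_(i < n) x ord0 i ^+ 2 +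
    dot *+ 2 + \sum_(i < n) y ord0 i ^+ 2.
  rewrite dotE -sumrMnl -!big_split; apply: eq_bigr => i _ /=.
  by rewrite mxE sqrrD.
by rewrite lerD2r lerD2l lerMn2r.
Qed.

Lemma measurable_enorm d (T : measurableType d) (f : T -> 'rV[R]_n) :
  measurable_fun [set: T] f -> measurable_fun [set: T] (@enorm R n \o f).
Proof.
move=> /measurable_fun_rVP mf.
have msqrt : measurable_fun [set: R] (@Num.sqrt R).
  by apply: continuous_measurable_fun; exact: sqrt_continuous.
apply: (measurableT_comp msqrt).
by apply: measurable_sum => i; apply: measurable_funX; exact: mf.
Qed.

End enorm_theory.

Section calculus.
Context {R : realType} {V W : normedModType R}.

Fixpoint iter_derive (vs : seq V) (f : V -> W) : V -> W :=
  if vs is v :: vs' then 'D_v (iter_derive vs' f) else f.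

Definition smooth (f : V -> W) : Prop := forall vs : seq V,
  continuous (iter_derive vs f) /\
  forall x v, derivable (iter_derive vs f) x v.

(* C_c^infty(V, W) *)
Definition test_function (f : V -> W) : Prop :=
  smooth f /\ compact (closure [set x | f x != 0]).

End calculus.

Section L2sigma.
Context {R : realType} (n : nat).
Local Notation Rn := 'rV[R]_n.

Definition L2norm (v : Rn -> Rn) : \bar R :=
  ('N[lebesgue_rV n]_2%:E[EFin \o (@enorm R n \o v)])%E.

(* Distributional divergence-freeness. *)
Definition weak_div_free (v : Rn -> Rn) : Prop :=
  forall psi : Rn -> R, test_function psi ->
    (\int[lebesgue_rV n]_x
      (\sum_(i < n) v x ord0 i * 'D_(delta_mx ord0 i) psi x)%:E = 0)%E.

Record L2sigma : Type := MkL2sigma {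
  L2sigma_val :> {mfun_ (lebesgue_rV n), Rn >-> Rn};
  L2sigma_fin : (L2norm L2sigma_val < +oo)%E;
  L2sigma_div : weak_div_free L2sigma_val }.

Lemma L2norm_triangle (u v w : Rn -> Rn) :
  measurable_fun [set: Rn] u -> measurable_fun [set: Rn] v ->
  measurable_fun [set: Rn] w ->
  (forall x, enorm (w x) <= enorm (u x) + enorm (v x)) ->
  (L2norm w <= L2norm u + L2norm v)%E.
Proof.
move=> mu mv mw wuv.
have := @minkowski_EFin _ _ _ (lebesgue_rV n) (@enorm R n \o u) (@enorm R n \o v)
  2 (measurable_enorm mu) (measurable_enorm mv) (ler1n _ 2).
apply: le_trans; rewrite /L2norm unlock.
apply: gt0_ler_poweR; rewrite ?invr_ge0// ?in_itv/= ?leey ?andbT.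
- by apply: integral_ge0 => x _; rewrite lee_fin powR_ge0.
- by apply: integral_ge0 => x _; rewrite lee_fin powR_ge0.
have mpow (f : Rn -> R) : measurable_fun [set: Rn] f ->
    measurable_fun [set: Rn] (fun x => (`|(EFin \o f) x| `^ 2)%E).
  move=> mf; apply: (measurableT_comp (measurable_poweR _)).
  by apply: measurableT_comp => //; exact/measurable_EFinP.
apply: ge0_le_integral => //.
- by apply: (mpow (@enorm R n \o w)); exact: measurable_enorm.
- have := mpow (fun x => enorm (u x) + enorm (v x)); apply.
  by apply: (@measurable_funD _ _ R _ (@enorm R n \o u) (@enorm R n \o v));
    exact: measurable_enorm.
move=> x _; rewrite /=.
rewrite !lee_fin ge0_ler_powR ?nnegrE ?normr_ge0//.
by rewrite !ger0_norm ?addr_ge0 ?enorm_ge0.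
Qed.

Lemma measurable_L2sigma (u : L2sigma) :
  measurable_fun [set: Rn] (u : Rn -> Rn).
Proof. exact: measurable_funP. Qed.

Lemma measurable_subrV (u v : Rn -> Rn) :
  measurable_fun [set: Rn] u -> measurable_fun [set: Rn] v ->
  measurable_fun [set: Rn] (fun x => u x - v x).
Proof.
move=> /measurable_fun_rVP mu /measurable_fun_rVP mv.
apply/measurable_fun_rVP => i; under eq_fun do rewrite !mxE.
exact: measurable_funB.
Qed.

Definition L2sigma_dist (u v : L2sigma) : R := fine (L2norm (fun x => u x - v x)).

Let L2sigma_distE (u v : L2sigma) :
  (L2sigma_dist u v)%:E = L2norm (fun x => u x - v x).
Proof.
rewrite /L2sigma_dist fineK// ge0_fin_numE ?Lnorm_ge0//.
apply: (@le_lt_trans _ _ (L2norm u + L2norm v)%E).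
  apply: L2norm_triangle => [|||x]; [exact: measurable_L2sigma..| |].
    by apply: measurable_subrV; exact: measurable_L2sigma.
  by rewrite (le_trans (enorm_triangle _ _))// enormN.
by rewrite lte_add_pinfty// L2sigma_fin.
Qed.

Let L2sigma_distxx u : L2sigma_dist u u = 0.
Proof.
rewrite /L2sigma_dist /L2norm (_ : EFin \o _ = cst 0%E) ?Lnorm0//.
apply/funext => x /=; congr EFin; rewrite /enorm big1 ?sqrtr0// => i _.
by rewrite subrr mxE expr0n.
Qed.

Let L2sigma_dist_sym u v : L2sigma_dist u v = L2sigma_dist v u.
Proof.
rewrite /L2sigma_dist /L2norm; congr (fine (Lnorm _ _ _)).
by apply/funext => x /=; rewrite -enormN opprB.
Qed.

Let L2sigma_dist_triangle v u w :
  L2sigma_dist u w <= L2sigma_dist u v + L2sigma_dist v w.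
Proof.
rewrite -lee_fin EFinD !L2sigma_distE.
apply: L2norm_triangle => [|||x]; last first.
  rewrite (_ : u x - w x = (u x - v x) + (v x - w x)) ?enorm_triangle//.
  by rewrite addrA subrK.
all: by apply: measurable_subrV; exact: measurable_L2sigma.
Qed.

Let L2sigma_dist_positivity u v : L2sigma_dist u v = 0 -> u = v.
Proof.
move=> uv0; have : L2norm (fun x => u x - v x) = 0%E.
  by rewrite -L2sigma_distE uv0.
move=> /Lnorm_eq0_eq0 uv.
have {}uv : (u : Rn -> Rn) = (v : Rn -> Rn) %[ae lebesgue_rV n].
  have muv : measurable_fun [set: Rn]
      (EFin \o (@enorm R n \o (fun x => u x - v x))).
    apply/measurable_EFinP; apply: measurable_enorm.
    by apply: measurable_subrV; exact: measurable_L2sigma.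
  apply: filterS (uv muv _) => // x /(_ I) /= [/enorm_eq0 uvx] _.
  by apply/eqP; rewrite -subr_eq0 uvx.
have val_uv : L2sigma_val u = L2sigma_val v.
  rewrite -(reprK (L2sigma_val u)) -(reprK (L2sigma_val v)).
  by apply/eqP; rewrite eqmodE; exact/asboolP.
case: u v {uv0 uv} val_uv => [u u1 u2] [v v1 v2] /= uv.
by subst v; congr MkL2sigma; exact: Prop_irrelevance.
Qed.

HB.instance Definition _ := gen_eqMixin L2sigma.
HB.instance Definition _ := gen_choiceMixin L2sigma.
HB.instance Definition _ := @isMetric.Build R L2sigma L2sigma_dist
  L2sigma_distxx L2sigma_dist_positivity L2sigma_dist_sym
  L2sigma_dist_triangle.

End L2sigma.

Definition nowhere_dense {T : topologicalType} (A : set T) : Prop :=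
  (closure A)° = set0.

(* Time-dependent fields are curried functions u x t; only their values for
   t >= 0 are used.  They are concrete functions, not classes modulo null sets:
   this gives a meaning to the energy inequality at every time t >= 0. *)
Section euler.
Context {R : realType} {n : nat}.
Local Notation Rn := 'rV[R]_n.
Local Notation time := (measurableTypeR R).
Implicit Types u : Rn -> R -> Rn.

Definition Linfty_L2sigma u : Prop :=
  [/\ measurable_fun [set p : Rn * time | 0 <= p.2] (fun p => u p.1 p.2),
      ('N[lebesgue_measure]_+oo[(fun t : time => L2norm (u ^~ t)) \_ `]0%R, +oo[]
        < +oo)%E &
      {ae lebesgue_measure, forall t : R, 0 < t -> weak_div_free (u ^~ t)}].

(* Partial derivative in the j-th space variable, resp. in time, of a field on
   space-time. *)
Definition dspace (j : 'I_n) (phi : Rn * R -> Rn) : Rn * R -> Rn :=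
  'D_(delta_mx ord0 j, 0) phi.
Definition dtime (phi : Rn * R -> Rn) : Rn * R -> Rn := 'D_(0, 1) phi.

(* Elements of C_c^infty(R^n x [0, oo), R^n) are the restrictions to t >= 0 of
   elements of C_c^infty(R^n x R, R^n); the constraint on the divergence only
   concerns t >= 0. *)
Definition weak_solution (u0 : Rn -> Rn) u : Prop :=
  forall phi : Rn * R -> Rn, test_function phi ->
    (forall x t, 0 <= t -> \sum_(j < n) dspace j phi (x, t) ord0 j = 0) ->
  (\int[lebesgue_measure]_(t in `[0%R, +oo[) \int[lebesgue_rV n]_x
     (\sum_(i < n) u x t ord0 i * dtime phi (x, t) ord0 i +
      \sum_(i < n) \sum_(j < n)
        u x t ord0 i * u x t ord0 j * dspace j phi (x, t) ord0 i)%:E +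
   \int[lebesgue_rV n]_x (\sum_(i < n) u0 x ord0 i * phi (x, 0) ord0 i)%:E
   = 0)%E.

Definition energy_inequality (u0 : Rn -> Rn) u : Prop := forall t : R, 0 <= t ->
  (\int[lebesgue_rV n]_x (enorm (u x t) ^+ 2)%:E <=
   \int[lebesgue_rV n]_x (enorm (u0 x) ^+ 2)%:E)%E.

(* Support of (the class of) u in R^n x [0, oo): the points no neighbourhood of
   which meets u in a null set only. *)
Definition ess_support u : set (Rn * R) :=
  [set p | 0 <= p.2 /\ forall U : set (Rn * R), open U -> U p ->
    ~ {ae (lebesgue_rV n \x lebesgue_measure)%E,
        forall q : Rn * time, U q -> 0 <= q.2 -> u q.1 q.2 = 0}].

Definition admissible_weak_solution (u0 : Rn -> Rn) u : Prop :=
  [/\ Linfty_L2sigma u, weak_solution u0 u & energy_inequality u0 u].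

End euler.

(* Main.v *)
Require Import Defs.
From mathcomp Require Import all_boot all_order all_algebra.
From mathcomp Require Import all_classical all_reals all_analysis.
From mathcomp Require Import measurable_realfun ring lra.

Set Implicit Arguments.
Unset Strict Implicit.
Unset Printing Implicit Defensive.
Import Order.TTheory GRing.Theory Num.Theory.
Import numFieldNormedType.Exports.

Local Open Scope classical_set_scope.
Local Open Scope ring_scope.

(** The total momentum in any smooth divergence-free direction changes slowly
    at large scales, so it cannot vanish by time [tau] when the initial datum
    has enough large-scale momentum.

    Let [u] be an admissible solution with datum [u0] which vanishes after time
    [tau], and let [Phi] be a divergence-free test field.  The weak formulation
    and the energy inequality give
      [|<u0, Phi(.,0)>| <= tau * sup_t int |u . d_t Phi + u (x) u : D Phi| dx],
    the time integral being restricted to [[0, tau]] since [u] is zero almost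
    everywhere afterwards ([ess_support_null], [momentum_bound]).

    Fix one such field, supported in the unit box of space-time, and rescale it
    to [Phi(k^2 x, k^2 t)] with [0 < k <= 1]; call [phi] the value at time 0.
    Then [int |phi|^2] is comparable with [k^(-2n)], while the derivatives of
    the field are [O(k^2)].  Estimating [|u| 1_B <= k^(-n) |u|^2 + k^n 1_B] on
    the support [B], whose volume is [O(k^(-2n))], one gets
      [|<u0, phi>| <= tau * C * k^2 * k^(-n) * (|u0|^2 + 1)]
    with [C] independent of [k] ([probe_field]).

    If the set of such data were dense in a ball of centre [v], it would
    contain data arbitrarily close to [v + s phi], where [|s|] is a fixed small
    multiple of [k^n], so that [s phi] is small in [L^2] uniformly in [k], and
    the sign of [s] is that of [<v, phi>].  The pairing of these data with
    [phi] is at least a fixed multiple of [k^(-n)], which contradicts the bound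
    above when [k] is small.

    To be admissible as a perturbation, [phi] has to be weakly divergence-free:
    this is integration by parts in [R^n] ([integral_partial_derivative],
    [div_free_weak]).  The test field is built explicitly from the flat
    function [exp(-1/x)]. *)

(** * Flat functions *)
Section flat.
Context {R : realType}.
Implicit Types (p : {poly R}) (x h : R).

(** The function [p(1/x) exp(-1/x)] extended by 0 to [x <= 0].  As [p] ranges
    over polynomials these functions form a family stable under derivation,
    which makes their smoothness a one-step induction. *)
Definition flat p x : R := if 0 < x then p.[x^-1] * expR (- x^-1) else 0.

Lemma exprn_le_expR n x : 0 <= x -> x ^+ n <= n`!%:R * expR x.
Proof.
move=> x0; case: n => [|n].
  by rewrite expr0 fact0 mul1r -expR0 ler_expR.
have := expR_ge1Dxn n x0; rewrite -lerBrDl => h.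
rewrite mulrC -ler_pdivrMr ?ltr0n ?fact_gt0//.
by apply: le_trans h _; rewrite gerBl.
Qed.

Lemma horner_expR_bounded p :
  exists2 C, 0 < C & forall x, 0 <= x -> `|p.[x] * expR (- x)| <= C.
Proof.
exists (\sum_(i < size p) `|p`_i| * i`!%:R + 1).
  by rewrite ltr_wpDl// sumr_ge0// => i _; rewrite mulr_ge0.
move=> x x0; rewrite horner_coef mulr_suml (le_trans (ler_norm_sum _ _ _))//.
rewrite ler_wpDr//.
apply: ler_sum => i _; rewrite !normrM -mulrA ler_wpM2l//.
rewrite !ger0_norm ?exprn_ge0 ?expR_ge0// expRN ler_pdivrMr ?expR_gt0//.
exact: exprn_le_expR.
Qed.

Lemma flat_quadratic p : exists2 C, 0 < C & forall x, `|flat p x| <= C * x ^+ 2.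
Proof.
have [C C0 pC] := horner_expR_bounded ('X^2 * p); exists C => // x.
rewrite /flat; case: ifPn => [x0|_]; last by rewrite normr0 mulr_ge0 ?sqr_ge0 ?ltW.
have x10 : 0 <= x^-1 by rewrite invr_ge0 ltW.
have := pC _ x10; rewrite hornerM hornerXn -mulrA normrM ger0_norm ?exprn_ge0//.
by rewrite exprVn mulrC ler_pdivrMr// exprn_gt0.
Qed.

Lemma flat_pos p x : 0 < x -> flat p x = p.[x^-1] * expR (- x^-1).
Proof. by rewrite /flat => ->. Qed.

Lemma flat_npos p x : x <= 0 -> flat p x = 0.
Proof. by rewrite /flat leNgt => /negbTE ->. Qed.

(** The polynomial [q] such that the derivative of [flat p] is [flat q]. *)
Definition flat_deriv p : {poly R} := 'X^2 * (p - p^`()).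

Lemma is_derive_flat p x : is_derive x (1 : R) (flat p) (flat (flat_deriv p) x).
Proof.
have [x0|x0|->] := ltgtP x 0.
- rewrite (flat_npos (flat_deriv p)) ?(ltW x0)//.
  apply: (@near_eq_is_derive _ _ _ (cst 0)).

  + near=> y; rewrite /= flat_npos//; near: y.
    by apply: filterS (lt_nbhsl x0) => y /ltW.
- rewrite (flat_pos _ x0).
  apply: (@near_eq_is_derive R R R (fun y => p.[y^-1] * expR (- y^-1))).

  + near=> y; rewrite /= flat_pos//; near: y; exact: (lt_nbhsr x0).
  have xn0 : x != 0 by rewrite gt_eqF.
  have dV : is_derive x (1:R) (fun y => y^-1) (- x ^- 2).
    apply: is_derive_eq; first by apply: is_deriveV.
    by rewrite /GRing.scale/= mulr1.
  have dp : is_derive x (1:R) (fun y => p.[y^-1]) (- x ^- 2 * p^`().[x^-1]).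
    rewrite mulrC; exact: (@is_derive1_comp _ (horner p) (fun y => y^-1)).
  have de : is_derive x (1:R) (fun y => expR (- y^-1)) (x ^- 2 * expR (- x^-1)).
    have dN : is_derive x (1:R) (fun y => - y^-1) (x ^- 2).
      by have := is_deriveN dV; rewrite opprK.
    rewrite mulrC; exact: (@is_derive1_comp _ expR (fun y => - y^-1)).
  apply: is_derive_eq.
  rewrite /GRing.scale/= /flat_deriv !hornerE/= exprVn; ring.
- rewrite flat_npos//; have [C C0 hC] := flat_quadratic p.
  suff h : h^-1 *: (flat p (h *: (1:R) + 0) - flat p 0) @[h --> 0^'] --> (0:R).
    by split; [apply/cvg_ex; exists 0|apply/cvg_lim].
  apply/cvgr0Pnorm_le => e e0; near=> h.
  rewrite [flat p 0]flat_npos// subr0 addr0 /GRing.scale/= mulr1 normrM normfV.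
  have hn0 : h != 0 by near: h; exact: nbhs_dnbhs_neq.
  rewrite ler_pdivrMl ?normr_gt0// (le_trans (hC h))//.
  rewrite -real_normK ?num_real// expr2 mulrA mulrC ler_wpM2l//.
  rewrite mulrC -ler_pdivlMr//.
  by near: h; apply: dnbhs0_le; rewrite divr_gt0.
Unshelve. all: by end_near. Qed.

Lemma continuous_flat p : continuous (flat p).
Proof.
move=> x; apply/differentiable_continuous/derivable1_diffP.
by have [] := is_derive_flat p x.
Qed.

End flat.

(** * Smooth functions and scaling *)
Lemma continuous_rV (R : realType) (T : topologicalType) n (f : T -> 'rV[R]_n) :
  (forall i, continuous (fun x => f x ord0 i)) -> continuous f.
Proof.
move=> cf x; apply/cvgrPdist_le => /= e e0; near=> y.
rewrite /Num.Def.normr/= mx_normrE (bigmax_le _ (ltW e0))//= => -[i j] _.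
rewrite !mxE/= (ord1 i) {i}; move: j; near: y; apply: filter_forall => /= j.
by have /cvgrPdist_le := cf j x; apply.
Unshelve. all: by end_near. Qed.

Section smooth_class.
Context {R : realType} {V : normedModType R}.
Implicit Types (f g l : V -> R) (x v : V).

(** Continuous affine functions; the second condition is affinity along each
    line, which is all that the chain rule below requires. *)
Definition affine l := continuous l /\
  forall v, exists k : R, forall x (h : R), l (h *: v + x) = h * k + l x.

Lemma is_derive_comp_affine (F dF : R -> R) l v k :
  (forall y : R, is_derive y (1 : R) F (dF y)) ->
  (forall x (h : R), l (h *: v + x) = h * k + l x) ->
  forall x, is_derive x v (F \o l) (k * dF (l x)).
Proof.
move=> dFP lk x.
have dg : is_derive (0:R) (1:R) (fun h : R => h * k + l x) k.
  apply: is_derive_eq.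
  by rewrite addr0 /GRing.scale/= mulr0 mulr1 add0r.
have Fg : is_derive (0:R) (1:R) (F \o (fun h : R => h * k + l x)) (dF (l x) * k).
  by apply: is_derive1_comp; rewrite mul0r add0r.
have E : (fun h : R => h^-1 *: ((F \o l) (h *: v + x) - (F \o l) x)) =
  (fun h : R => h^-1 *: ((F \o (fun h : R => h * k + l x)) (h *: (1:R) + 0)
      - (F \o (fun h : R => h * k + l x)) 0)).
  apply/funext => h /=; rewrite lk addr0 mul0r add0r.
  by rewrite /GRing.scale/= mulr1.
case: Fg; rewrite /derivable /derive -E mulrC => ? ?.
by split.
Qed.

(** An algebra of smooth functions, generated by the constants and the
    compositions of flat functions with affine functions.  It is closed under
    directional derivatives, hence consists of smooth functions. *)
Inductive smooth_class : (V -> R) -> Prop :=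
| smooth_class_cst c : smooth_class (cst c)
| smooth_class_flat p l : affine l -> smooth_class (flat p \o l)
| smooth_class_add f g : smooth_class f -> smooth_class g ->
    smooth_class (fun x => f x + g x)
| smooth_class_mul f g : smooth_class f -> smooth_class g ->
    smooth_class (fun x => f x * g x).

Lemma smooth_class_continuous f : smooth_class f -> continuous f.
Proof.
elim=> {f} [c|p l [cl _]|f g _ cf _ cg|f g _ cf _ cg] x.
- exact: cvg_cst.
- by apply: continuous_comp; [exact: cl|exact: continuous_flat].
- by apply: cvgD; [exact: cf|exact: cg].
- by apply: cvgM; [exact: cf|exact: cg].
Qed.

Lemma smooth_class_derive v f : smooth_class f ->
  exists2 g, smooth_class g & forall x, is_derive x v f (g x).
Proof.
elim=> {f} [c|p l al|f g sf [f' sf' df] sg [g' sg' dg]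
    |f g sf [f' sf' df] sg [g' sg' dg]].
- by exists (cst 0); [exact: smooth_class_cst|move=> x; exact: is_derive_cst].
- have [_ /(_ v)[k lk]] := al.
  exists (fun x => cst k x * (flat (flat_deriv p) \o l) x).
    by apply: smooth_class_mul; [exact: smooth_class_cst|exact: smooth_class_flat].
  by move=> x; apply: is_derive_comp_affine => // y; exact: is_derive_flat.
- exists (fun x => f' x + g' x); first exact: smooth_class_add.
  by move=> x; exact: is_deriveD.
- exists (fun x => f x * g' x + g x * f' x).
    by apply: smooth_class_add; apply: smooth_class_mul.
  by move=> x; exact: is_deriveM.
Qed.

Lemma smooth_class_prod (I : Type) (r : seq I) (F : I -> V -> R) :
  (forall i, smooth_class (F i)) -> smooth_class (fun x => \prod_(i <- r) F i x).
Proof.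
move=> sF; elim: r => [|i r ih].
  under eq_fun do rewrite big_nil.
  exact: smooth_class_cst.
by under eq_fun do rewrite big_cons; exact: smooth_class_mul.
Qed.

(** Vector fields whose coordinates all lie in [smooth_class]. *)
Definition smooth_class_rV n (f : V -> 'rV[R]_n) :=
  forall i, smooth_class (fun x => f x ord0 i).

Lemma smooth_class_rV_derive n v (f : V -> 'rV[R]_n) : smooth_class_rV f ->
  (forall x, derivable f x v) /\ smooth_class_rV ('D_v f).
Proof.
move=> sf; have df x : derivable f x v.
  apply/derivable_mxP => i j; rewrite (ord1 i).
  by have [g _ fg] := smooth_class_derive v (sf j); have [] := fg x.
split=> // i; have [g sg fg] := smooth_class_derive v (sf i).
rewrite (_ : (fun x => _) = g)//; apply/funext => x.
by rewrite derive_mx// mxE; have [] := fg x.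
Qed.

Lemma smooth_class_rV_smooth n (f : V -> 'rV[R]_n) :
  smooth_class_rV f -> smooth f.
Proof.
move=> sf0 vs; have sf : smooth_class_rV (iter_derive vs f).
  by elim: vs => //= v vs /smooth_class_rV_derive - /(_ v)[].
split; last by move=> x v; have [] := smooth_class_rV_derive v sf.
by apply: continuous_rV => i; exact: smooth_class_continuous.
Qed.

End smooth_class.

Section test_function_scale.
Context {R : realType} {V W : normedModType R}.
Variables (e : R) (e0 : 0 < e).
Implicit Types f : V -> W.

Lemma is_derive_scale f (v x : V) : derivable f (e *: x) v ->
  is_derive x v (fun y => f (e *: y)) (e *: 'D_v f (e *: x)).
Proof.
move=> df; have en0 : e != 0 by rewrite gt_eqF.
suff h : h^-1 *: (f (e *: (h *: v + x)) - f (e *: x)) @[h --> 0^'] -->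
    e *: 'D_v f (e *: x).
  by split; [apply/cvg_ex; eexists; exact: h|apply/cvg_lim].
have -> : (fun h => h^-1 *: (f (e *: (h *: v + x)) - f (e *: x))) =
  (fun h => e *: ((fun k : R => k^-1 *: (f (k *: v + e *: x) - f (e *: x))) (e * h))).
  apply/funext => h /=; rewrite [RHS]scalerA invfM mulVKf//.
  by rewrite (scalerDr e) (scalerA e h v).
apply: cvgZr; apply: (cvg_comp (fun h : R => e * h) _ _ df).
move=> A [d /= d0 dA]; exists (d / e); first by rewrite /= divr_gt0.
move=> h /= hd hn0; apply: dA; last by rewrite mulf_neq0.
move: hd; rewrite /ball_/= !sub0r !normrN normrM (gtr0_norm e0).
by rewrite ltr_pdivlMr// mulrC.
Qed.

Lemma iter_derive_scale f vs : smooth f ->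
  iter_derive vs (fun y => f (e *: y)) =
  fun y => e ^+ size vs *: iter_derive vs f (e *: y).
Proof.
move=> sf; elim: vs => [|v vs ih] /=.
  by apply/funext => y; rewrite expr0 scale1r.
rewrite ih; apply/funext => y; have [_ df] := sf vs.
have := is_derive_scale (df (e *: y) v).
move=> /(is_deriveZ (e ^+ size vs)) [_]; rewrite /derive_val => ->.
by rewrite scalerA -exprSr.
Qed.

Lemma smooth_scale f : smooth f -> smooth (fun y => f (e *: y)).
Proof.
move=> sf vs; rewrite iter_derive_scale//; have [cf df] := sf vs.
split=> [x|x v].
  apply: cvgZr; apply: (@continuous_comp _ _ _ ( *:%R e)); last exact: cf.
  exact: scaler_continuous.
by have [] := is_deriveZ (e ^+ size vs) (is_derive_scale (df (e *: x) v)).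
Qed.

End test_function_scale.

(** * A divergence-free test field *)
Section bump.
Context {R : realType}.
Implicit Types t : R.

(** A bump function, positive on [(-1, 1)] and zero elsewhere. *)
Definition bump t : R := flat 1 (1 + t) * flat 1 (1 - t).

(** The derivative of [bump]. *)
Definition dbump t : R := flat (flat_deriv 1) (1 + t) * flat 1 (1 - t)
  - flat 1 (1 + t) * flat (flat_deriv 1) (1 - t).

Lemma is_derive_bump t : is_derive t (1 : R) bump (dbump t).
Proof.
have d1 : is_derive t (1 : R) (fun t : R => 1 + t) 1.
  by apply: is_derive_eq; rewrite add0r mulr1.
have d2 : is_derive t (1 : R) (fun t : R => 1 - t) (- 1).
  by apply: is_derive_eq; rewrite add0r mul1r.
have f1 : is_derive t (1 : R) (fun t : R => flat 1 (1 + t))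
    (flat (flat_deriv 1) (1 + t) * 1).
  exact: (@is_derive1_comp _ (flat 1) (fun t : R => 1 + t) _ _ _
    (is_derive_flat 1 _) d1).
have f2 : is_derive t (1 : R) (fun t : R => flat 1 (1 - t))
    (flat (flat_deriv 1) (1 - t) * (- 1)).
  exact: (@is_derive1_comp _ (flat 1) (fun t : R => 1 - t) _ _ _
    (is_derive_flat 1 _) d2).
apply: (is_derive_eq (is_deriveM f1 f2)).
by rewrite /GRing.scale/= /dbump; ring.
Qed.

Lemma bump_out t : 1 <= `|t| -> bump t = 0.
Proof.
rewrite /bump ler_normr => /orP[t1|t1].
  by rewrite [X in _ * X]flat_npos ?mulr0// subr_le0.
by rewrite [X in X * _]flat_npos ?mul0r// -lerBrDl sub0r lerNr.
Qed.

Lemma dbump_out t : 1 <= `|t| -> dbump t = 0.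
Proof.
rewrite /dbump ler_normr => /orP[t1|t1].
  by rewrite !(flat_npos _ (_ : 1 - t <= 0)) ?mulr0 ?subr0// subr_le0.
by rewrite !(flat_npos _ (_ : 1 + t <= 0)) ?mul0r ?subr0// -lerBrDl sub0r lerNr.
Qed.

Lemma flat1_gt0 t : 0 < t -> 0 < flat 1 t.
Proof. by move=> t0; rewrite flat_pos// hornerC mul1r expR_gt0. Qed.

Lemma bump_gt0 t : `|t| < 1 -> 0 < bump t.
Proof.
rewrite ltr_norml => /andP[t1 t2].
by rewrite mulr_gt0// flat1_gt0// ?subr_gt0// -ltrBlDl sub0r.
Qed.

Lemma dbump_half_neq0 : dbump 2^-1 != 0.
Proof.
have flat1 t : 0 < t -> flat (flat_deriv 1) t = t^-1 ^+ 2 * flat 1 t.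
  move=> t0; rewrite !flat_pos// /flat_deriv derivC subr0 mulr1 hornerXn.
  by rewrite hornerC mul1r.
have p1 : 0 < 1 + 2^-1 :> R by rewrite addr_gt0.
have p2 : 0 < 1 - 2^-1 :> R by rewrite subr_gt0 invf_lt1// ltr1n.
rewrite /dbump (flat1 _ p1) (flat1 _ p2).
set a := flat _ _; set b := flat _ _.
have -> : (1 + 2^-1)^-1 ^+ 2 * a * b - a * ((1 - 2^-1)^-1 ^+ 2 * b) =
  - (32 / 9 * (a * b)) by field.
by rewrite oppr_eq0 !mulf_neq0// ?gt_eqF ?flat1_gt0.
Qed.

End bump.

Section field.
Context {R : realType} {n : nat}.
Variables (i0 i1 : 'I_n).
Hypothesis i01 : i0 != i1.
Local Notation Rn := 'rV[R]_n.
Implicit Types p : Rn * R.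

(** The bump function in the i-th space coordinate, and its derivative. *)
Definition xbump (i : 'I_n) p : R := bump (p.1 ord0 i).
Definition xdbump (i : 'I_n) p : R := dbump (p.1 ord0 i).
(** The product of the bumps in time and in the space coordinates other than
    [i0] and [i1]. *)
Definition bump_tail p : R :=
  (\prod_(i | (i != i0) && (i != i1)) xbump i p) * bump p.2.

(** The field [(d_1 Psi, - d_0 Psi)] in the coordinates [i0] and [i1], where
    [Psi] is the product of the bumps in all space-time coordinates.  Writing it
    in product form makes the vanishing of the divergence an explicit
    cancellation, without symmetry of second derivatives. *)
Definition swirl p : Rn := \row_j
  if j == i0 then xbump i0 p * (xdbump i1 p * bump_tail p)
  else if j == i1 then xbump i1 p * (-1 * (xdbump i0 p * bump_tail p))
  else 0.

Lemma affine_coord (a b : R) (i : 'I_n) :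
  affine (fun p : Rn * R => a + b * p.1 ord0 i).
Proof.
split=> [p|v].
  apply: cvgD; first exact: cvg_cst.
  apply: cvgMr; apply: (@continuous_comp _ _ _ fst (fun x : Rn => x ord0 i)).
    exact: cvg_fst.
  exact: coord_continuous.
by exists (b * v.1 ord0 i) => x h; rewrite /= !mxE; ring.
Qed.

Lemma affine_time (a b : R) : affine (fun p : Rn * R => a + b * p.2).
Proof.
split=> [p|v].
  apply: cvgD; first exact: cvg_cst.
  by apply: cvgMr; exact: cvg_snd.
by exists (b * v.2) => x h; rewrite /= /GRing.scale/=; ring.
Qed.

Lemma smooth_class_bump (l : Rn * R -> R) :
  affine (fun p => 1 + 1 * l p) -> affine (fun p => 1 + -1 * l p) ->
  smooth_class (fun p => bump (l p)) /\ smooth_class (fun p => dbump (l p)).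
Proof.
move=> a1 a2; split.
  rewrite (_ : (fun p => _) = fun p => (flat 1 \o (fun p => 1 + 1 * l p)) p *
    (flat 1 \o (fun p => 1 + -1 * l p)) p).
    by apply: smooth_class_mul; exact: smooth_class_flat.
  by apply/funext => p /=; rewrite mul1r mulN1r.
rewrite (_ : (fun p => _) = fun p =>
    (flat (flat_deriv 1) \o (fun p => 1 + 1 * l p)) p *
    (flat 1 \o (fun p => 1 + -1 * l p)) p +
    cst (-1) p * ((flat 1 \o (fun p => 1 + 1 * l p)) p *
    (flat (flat_deriv 1) \o (fun p => 1 + -1 * l p)) p)).
  apply: smooth_class_add.
    by apply: smooth_class_mul; exact: smooth_class_flat.
  apply: smooth_class_mul; first exact: smooth_class_cst.
  by apply: smooth_class_mul; exact: smooth_class_flat.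
by apply/funext => p /=; rewrite mul1r !mulN1r.
Qed.

Lemma smooth_class_swirl : smooth_class_rV swirl.
Proof.
have sb i : smooth_class (xbump i) by apply: (smooth_class_bump _ _).1;
  exact: affine_coord.
have sd i : smooth_class (xdbump i) by apply: (smooth_class_bump _ _).2;
  exact: affine_coord.
have st : smooth_class bump_tail.
  apply: smooth_class_mul; last by apply: (smooth_class_bump _ _).1;
    exact: affine_time.
  under eq_fun do rewrite -big_filter.
  exact: smooth_class_prod.
move=> j; under eq_fun do rewrite mxE.
case: (j == i0); last case: (j == i1).
- by apply: smooth_class_mul => //; exact: smooth_class_mul.
- apply: smooth_class_mul => //; apply: (@smooth_class_mul _ _ (cst (-1))).
    exact: smooth_class_cst.
  exact: smooth_class_mul.
- exact: smooth_class_cst.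
Qed.

Lemma swirl_out p : (exists i, 1 <= `|p.1 ord0 i|) \/ 1 <= `|p.2| -> swirl p = 0.
Proof.
move=> h; apply/rowP => j; rewrite !mxE.
have [_|ji0] := eqVneq j i0; last have [_|ji1] := eqVneq j i1 => //.
all: case: h => [[i pi]|p2]; last by
  rewrite /bump_tail (bump_out p2) !(mulr0,mul0r).
all: have [xb xd] : xbump i p = 0 /\ xdbump i p = 0
  by split; [exact: bump_out|exact: dbump_out].
all: have [ii0|ii0] := eqVneq i i0;
  first by rewrite -ii0 ?xb ?xd !(mulr0,mul0r).
all: have [ii1|ii1] := eqVneq i i1;
  first by rewrite -ii1 ?xb ?xd !(mulr0,mul0r).
all: suff -> : bump_tail p = 0 by rewrite !mulr0.
all: rewrite /bump_tail (bigD1 i)/= ?ii0 ?ii1//.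
all: by rewrite xb !mul0r.
Qed.

Lemma is_derive_const_along (f : Rn * R -> R) p v :
  (forall h : R, f (h *: v + p) = f p) -> is_derive p v f 0.
Proof.
move=> fv; have E : (fun h : R => h^-1 *: (f (h *: v + p) - f p)) = cst 0.
  by apply/funext => h; rewrite fv subrr scaler0.
by split; rewrite /derivable /derive E; [exact: is_cvg_cst|exact: lim_cst].
Qed.

Lemma sum_opposite_pair (g : 'I_n -> R) a : g i0 = a -> g i1 = - a ->
  (forall j, j != i0 -> j != i1 -> g j = 0) -> \sum_j g j = 0.
Proof.
move=> g0 g1 gj; rewrite (bigD1 i0)// (bigD1 i1) ?(eq_sym i1)//= g0 g1 big1.
  by rewrite addr0 subrr.
by move=> j /andP[ji0 ji1]; exact: gj.
Qed.

Lemma swirl_div0 p : \sum_(j < n) dspace j swirl p ord0 j = 0.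
Proof.
have dE j : dspace j swirl p ord0 j =
    'D_(delta_mx ord0 j, 0) (fun p => swirl p ord0 j) p.
  rewrite /dspace derive_mx ?mxE//.
  by have [] := smooth_class_rV_derive (delta_mx ord0 j, 0) smooth_class_swirl.
have shift j i (h : R) : i != j ->
    (h *: ((delta_mx ord0 j, 0) : Rn * R) + p).1 ord0 i = p.1 ord0 i.
  by move=> ij; rewrite /= !mxE eqxx/= (negbTE ij) mulr0 add0r.
have tr j (h : R) : (j == i0) || (j == i1) ->
    bump_tail (h *: ((delta_mx ord0 j, 0) : Rn * R) + p) = bump_tail p.
  move=> ji; rewrite /bump_tail; congr (_ * _); last first.
    by rewrite /= /GRing.scale/= mulr0 add0r.
  apply: eq_bigr => i /andP[ii0 ii1]; rewrite /xbump shift//.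
  by case/orP: ji => /eqP ->.
have xb j : is_derive p (delta_mx ord0 j, 0) (xbump j) (xdbump j p).
  rewrite -[xdbump j p]mul1r.
  apply: (@is_derive_comp_affine _ _ bump dbump (fun p => p.1 ord0 j)).
    exact: is_derive_bump.
  by move=> q h; rewrite /= !mxE !eqxx.
have E0 : dspace i0 swirl p ord0 i0 = xdbump i1 p * bump_tail p * xdbump i0 p.
  rewrite (dE i0); have -> : (fun p => swirl p ord0 i0) =
      (fun p => xbump i0 p * (xdbump i1 p * bump_tail p)).
    by apply/funext => q; rewrite mxE eqxx.
  have c0 : is_derive p (delta_mx ord0 i0, 0)
      (fun p => xdbump i1 p * bump_tail p) 0.
    apply: is_derive_const_along => h; rewrite tr ?eqxx// /xdbump shift//.
    by rewrite eq_sym.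
  have [_ ->] := is_deriveM (xb i0) c0.
  by rewrite /GRing.scale/= mulr0 add0r.
have E1 : dspace i1 swirl p ord0 i1 = - (xdbump i1 p * bump_tail p * xdbump i0 p).
  rewrite (dE i1); have -> : (fun p => swirl p ord0 i1) =
      (fun p => xbump i1 p * (-1 * (xdbump i0 p * bump_tail p))).
    by apply/funext => q; rewrite mxE (negbTE (_ : i1 != i0)) ?eqxx// eq_sym.
  have c1 : is_derive p (delta_mx ord0 i1, 0)
      (fun p => -1 * (xdbump i0 p * bump_tail p)) 0.
    by apply: is_derive_const_along => h; rewrite tr ?eqxx ?orbT// /xdbump shift.
  have [_ ->] := is_deriveM (xb i1) c1.
  by rewrite /GRing.scale/= mulr0 add0r; ring.
have E j : j != i0 -> j != i1 -> dspace j swirl p ord0 j = 0.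
  move=> ji0 ji1; rewrite (dE j) (_ : (fun p => _) = cst 0) ?derive_cst//.
  by apply/funext => q; rewrite mxE (negbTE ji0) (negbTE ji1).
exact: (@sum_opposite_pair (fun j => dspace j swirl p ord0 j) _ E0 E1 E).
Qed.

Lemma swirl_half_neq0 : swirl (const_mx 2^-1, 0) ord0 i0 != 0.
Proof.
have h1 : `|2^-1| < 1 :> R by rewrite gtr0_norm// invf_lt1// ltr1n.
rewrite !mxE eqxx /xbump /xdbump /bump_tail /xbump !mxE.
apply: mulf_neq0; first by rewrite gt_eqF// bump_gt0.
apply: mulf_neq0; first exact: dbump_half_neq0.
apply: mulf_neq0; last by rewrite gt_eqF// bump_gt0//= normr0.
by rewrite gt_eqF//; apply: prodr_gt0 => i _; rewrite mxE bump_gt0.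
Qed.

End field.

Lemma continuous_pair_cst (T U : topologicalType) (u : U) :
  continuous (fun x : T => (x, u)).
Proof.
move=> x A [[B C]/= [Bx Cu] BC]; apply: filterS Bx => y By.
by apply: BC; split=> //=; exact: nbhs_singleton.
Qed.

Lemma compact_support_bounded (R : realType) (T : topologicalType)
    (W : normedModType R) (K : set T) (f : T -> W) :
  compact K -> continuous f -> (forall p, f p != 0 -> K p) ->
  exists2 C, 0 < C & forall p, `|f p| <= C.
Proof.
move=> cK cf fK; have /compact_bounded : compact (f @` K).
  by apply: continuous_compact => //; exact: continuous_subspaceT.
move=> /ex_strict_bound_gt0[C C0 /= hC]; exists C => // p.
have [->|fp0] := eqVneq (f p) 0; first by rewrite normr0 ltW.
by rewrite ltW//; apply: hC; exists p => //; exact: fK.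
Qed.

Lemma derive_closed_support (R : realType) (V W : normedModType R) (h : V -> W)
    (K : set V) v p :
  closed K -> (forall p, h p != 0 -> K p) -> 'D_v h p != 0 -> K p.
Proof.
move=> cK hK; apply: contra_neqP => pK.
rewrite (@near_eq_derive _ _ _ h (cst 0)) ?derive_cst//.
have : nbhs p (~` K).
  by apply: open_nbhs_nbhs; split => //; exact/closed_openC.
apply: filterS => q qK; apply/eqP; apply: contra_notT qK; exact: hK.
Qed.

Section box.
Context {R : realType} {n : nat}.
Local Notation Rn := 'rV[R]_n.
Implicit Types p : Rn * R.

(** The box of half-width [M] in space-time, a cylinder over the cube. *)
Definition box (M : R) : set (Rn * R) :=
  [set x : Rn | forall i, `[- M, M]%classic (x ord0 i)] `*` `[- M, M].

Lemma compact_box M : compact (box M).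
Proof.
apply: compact_setX; last exact: segment_compact.
by apply: (@rV_compact _ _ (fun=> `[- M, M]%classic)) => _; exact: segment_compact.
Qed.

Lemma closed_box M : closed (box M).
Proof. by apply: compact_closed; [exact: norm_hausdorff|exact: compact_box]. Qed.

Lemma box_test_function (W : normedModType R) (f : Rn * R -> W) M : smooth f ->
  (forall p, f p != 0 -> box M p) -> test_function f.
Proof.
move=> sf fM; split=> //; apply: subclosed_compact (@compact_box M) _.
  exact: closed_closure.
have /closure_id -> := @closed_box M.
by apply: closure_subset => p /fM.
Qed.

Lemma box_bounded (W : normedModType R) (f : Rn * R -> W) M : continuous f ->
  (forall p, f p != 0 -> box M p) -> exists2 C, 0 < C & forall p, `|f p| <= C.
Proof. by apply: compact_support_bounded; exact: compact_box. Qed.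

Lemma ler_mx_norm (x : Rn) i : `|x ord0 i| <= `|x|.
Proof.
rewrite [leRHS]/Num.Def.normr/= mx_normrE.
exact: (le_bigmax _ (fun ij : 'I_1 * 'I_n => `|x ij.1 ij.2|) (ord0, i)).
Qed.

(** The properties of [swirl] used in the sequel, with explicit constants: the
    last bound holds on a small cube around a point where the field is nonzero
    at time 0. *)
Lemma test_field_exists : (2 <= n)%N ->
  exists (Phi : Rn * R -> Rn) (C c a b : R), [/\ 0 < C, 0 < c & a < b] /\
  [/\ smooth Phi,
      (forall p, Phi p != 0 -> box 1 p),
      (forall p, \sum_(j < n) dspace j Phi p ord0 j = 0),
      (forall p, (exists i, 1 <= `|p.1 ord0 i|) ->
        Phi p = 0 /\ dtime Phi p = 0) &
      [/\ (forall p i, `|Phi p ord0 i| <= C),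
        (forall p i, `|dtime Phi p ord0 i| <= C),
        (forall p i j, `|dspace j Phi p ord0 i| <= C) &
        (forall x : Rn, (forall i, a <= x ord0 i <= b) ->
          c <= \sum_(i < n) Phi (x, 0) ord0 i ^+ 2)]].
Proof.
move=> n2; pose i0 : 'I_n := Ordinal (ltn_trans (ltn0Sn 0) n2).
pose i1 : 'I_n := Ordinal n2; have i01 : i0 != i1 by [].
pose Phi : Rn * R -> Rn := swirl i0 i1.
have sPhi : smooth Phi.
  exact/smooth_class_rV_smooth/smooth_class_swirl.
have Phi_out p : (exists i, 1 <= `|p.1 ord0 i|) -> Phi p = 0.
  by move=> h; apply: swirl_out; left.
have Phi_box p : Phi p != 0 -> box 1 p.
  apply: contra_neqP => pM; apply: swirl_out.
  apply: contra_notP pM => /not_orP[p1 p2]; split => [i|] /=.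
    rewrite in_itv/= -ler_norml leNgt; apply/negP => /ltW h.
    by apply: p1; exists i.
  by rewrite in_itv/= -ler_norml leNgt; apply/negP => /ltW.
have bnd v : exists2 C, 0 < C & forall p, `|'D_v Phi p| <= C.
  apply: (box_bounded (M := 1)); first by have [] := sPhi [:: v].
  by move=> p; apply: derive_closed_support => //; exact: closed_box.
have [C0 C00 hC0] : exists2 C, 0 < C & forall p, `|Phi p| <= C.
  by apply: (box_bounded (M := 1)) => //; have [] := sPhi [::].
have [C1 C10 hC1] := bnd (0, 1).
have /choice[D hD] : forall j : 'I_n, exists C, 0 < C /\
    forall p, `|dspace j Phi p| <= C.
  by move=> j; have [C ? ?] := bnd (delta_mx ord0 j, 0); exists C.
have [a [b [c [ab c0 hc]]]] : exists a b c : R, [/\ a < b, 0 < c &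
    forall x : Rn, (forall i, a <= x ord0 i <= b) ->
      c <= \sum_(i < n) Phi (x, 0) ord0 i ^+ 2].
  pose g (x : Rn) := Phi (x, 0) ord0 i0.
  have cg : continuous g.
    move=> x; apply: (@continuous_comp _ _ _ (fun x => Phi (x, 0))
      (fun y : Rn => y ord0 i0)); last exact: coord_continuous.
    apply: (@continuous_comp _ _ _ (fun x : Rn => (x, 0 : R)) Phi).
      exact: continuous_pair_cst.
    exact: (sPhi [::]).1.
  have g0 : 0 < `|g (const_mx 2^-1)| by rewrite normr_gt0 swirl_half_neq0.
  pose m := `|g (const_mx 2^-1)| / 2.
  have m0 : 0 < m by rewrite divr_gt0.
  have /cvgrPdist_le /(_ m m0) /nbhs_ballP[d /= d0 hd] := cg (const_mx 2^-1).
  exists (2^-1 - d / 2), (2^-1 + d / 2), (m ^+ 2).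
  split; first by move: d0; lra.
    by rewrite exprn_gt0.
  move=> x hx; have gx : m <= `|g x|.
    have : `|g (const_mx 2^-1) - g x| <= m.
      apply: hd; rewrite mx_norm_ball/= /ball_/= /Num.Def.normr/= mx_normrE.
      apply: bigmax_lt => //= -[i j] _; rewrite !mxE (ord1 i).
      by rewrite (@le_lt_trans _ _ (d / 2))// ?gtr_pMr ?invf_lt1 ?ltr1n// ler_distlC.
    have := ler_distD (g x) (g (const_mx 2^-1)) 0; rewrite !subr0 /m; lra.
  rewrite (bigD1 i0)//= ler_wpDr//; first by apply: sumr_ge0 => i _; exact: sqr_ge0.
  by rewrite -[leRHS]real_normK ?num_real// lerXn2r ?nnegrE// ltW.
exists Phi, (C0 + C1 + \sum_j D j), c, a, b; split.
  split=> //; rewrite ltr_wpDr ?addr_gt0// sumr_ge0// => j _.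
  by rewrite ltW//; have [] := hD j.
have D0 : 0 <= \sum_j D j.
  by apply: sumr_ge0 => j _; rewrite ltW//; have [] := hD j.
split=> // [p|p [i pi]|]; first exact: (swirl_div0 i01).
  split; first by apply: Phi_out; exists i.
  rewrite /dtime /derive (_ : (fun h => _) = cst 0) ?lim_cst//.
  have P0 (q : Rn * R) : q.1 ord0 i = p.1 ord0 i -> Phi q = 0.
    by move=> qp; apply: Phi_out; exists i; rewrite qp.
  apply/funext => h /=; rewrite (P0 p)// P0 ?subrr ?scaler0//.
  by rewrite /= !mxE mulr0 add0r.
split=> // [p i|p i|p i j].
- rewrite (le_trans (ler_mx_norm _ _))// (le_trans (hC0 _))//.
  by rewrite -addrA lerDl addr_ge0// ltW.
- rewrite (le_trans (ler_mx_norm _ _))// (le_trans (hC1 _))//.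
  by rewrite addrAC lerDr addr_ge0// ltW.
- rewrite (le_trans (ler_mx_norm _ _))//.
  have [_ /(_ p) h] := hD j; rewrite (le_trans h)//.
  apply: ler_wpDl; first by rewrite addr_ge0// ltW.
  rewrite (bigD1 j)//= lerDl; apply: sumr_ge0 => k _.
  by rewrite ltW//; have [] := hD k.
Qed.

(** The previous field composed with [p |-> e p]: its derivatives gain a factor
    [e], while the constants do not depend on [e]. *)
Lemma test_field_scaled : (2 <= n)%N ->
  exists C c a b : R, [/\ 0 < C, 0 < c & a < b] /\
  forall e, 0 < e -> exists Phi : Rn * R -> Rn,
  [/\ test_function Phi,
      (forall p, \sum_(j < n) dspace j Phi p ord0 j = 0),
      (forall p, (exists i, e^-1 <= `|p.1 ord0 i|) -> Phi p = 0 /\ dtime Phi p = 0) &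
      [/\ (forall p i, `|Phi p ord0 i| <= C),
        (forall p i, `|dtime Phi p ord0 i| <= e * C),
        (forall p i j, `|dspace j Phi p ord0 i| <= e * C) &
        (forall x : Rn, (forall i, e^-1 * a <= x ord0 i <= e^-1 * b) ->
          c <= \sum_(i < n) Phi (x, 0) ord0 i ^+ 2)]].
Proof.
move=> n2; have [Phi [C [c [a [b [[C0 c0 ab]]]]]]] := test_field_exists n2.
move=> [sPhi Phi_box div0 dt_out [PhiC dtC dsC Phic]].
exists C, c, a, b; split=> // e e0; exists (fun p => Phi (e *: p)).
have dE v p : 'D_v (fun p => Phi (e *: p)) p = e *: 'D_v Phi (e *: p).
  have [_ dPhi] := sPhi [::].
  by have [_ ->] := is_derive_scale e0 (dPhi (e *: p) v).
have e1 : 0 < e^-1 by rewrite invr_gt0.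
have in_itv1 (r : R) : `[-1, 1]%classic (e * r) -> `[- e^-1, e^-1]%classic r.
  rewrite /= !in_itv/= -!ler_norml normrM gtr0_norm//.
  by rewrite -ler_pdivlMl// mulr1.
split.
- apply: (box_test_function (M := e^-1)); first exact: smooth_scale.
  move=> p /Phi_box[/= p1 p2]; split=> [i|/=]; last exact: in_itv1.
  by apply: in_itv1; have := p1 i; rewrite mxE.
- move=> p; under eq_bigr do rewrite /dspace dE mxE.
  by rewrite -mulr_sumr div0 mulr0.
- move=> p [i pi]; have pe : 1 <= `|(e *: p).1 ord0 i|.
    by rewrite /= mxE normrM gtr0_norm// -ler_pdivrMl// mulr1.
  have [P0 dP0] := dt_out _ (ex_intro _ i pe).
  by rewrite /dtime dE P0 -/(dtime Phi _) dP0 scaler0.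
- split=> [//|p i|p i j|x hx].
  + by rewrite /dtime dE mxE normrM gtr0_norm// ler_pM2l//; exact: dtC.
  + by rewrite /dspace dE mxE normrM gtr0_norm// ler_pM2l//; exact: dsC.
  + rewrite (_ : e *: (x, 0) = (e *: x, 0)); last by congr pair; exact: mulr0.
    apply: Phic => i; rewrite mxE.
    by have := hx i; rewrite ler_pdivrMl// ler_pdivlMl.
Qed.

End box.

(** * Continuous functions on R^n are measurable *)
Section borel_rV.
Context {R : realType} {n : nat}.
Local Notation Rn := 'rV[R]_n.

(** Open cubes with rational centre and half-width [1/(k+1)]; they form a
    countable basis of the topology, whence open sets are measurable. *)
Definition rat_cube (q : 'rV[rat]_n) (k : nat) : set Rn :=
  [set x | forall i, `|x ord0 i - ratr (q ord0 i)| < k.+1%:R^-1].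

Lemma rat_approx (x e : R) : 0 < e -> exists q : rat, `|x - ratr q| < e.
Proof.
move=> e0; have : x - e < x + e by rewrite ltrBlDr -addrA ltrDl addr_gt0.
move=> /rat_in_itvoo[q]; rewrite in_itv/= => /andP[q1 q2]; exists q.
by rewrite ltr_distl; apply/andP; split; [move: q2; lra|move: q1; lra].
Qed.

Lemma measurable_cube (a : 'I_n -> set R) : (forall i, measurable (a i)) ->
  measurable [set x : Rn | forall i, a i (x ord0 i)].
Proof.
move=> ma; rewrite (_ : [set _ | _] = \bigcap_(i in [set: 'I_n])
    ((fun x : Rn => x ord0 i) @^-1` a i)); last first.
  by rewrite predeqE => x; split => [h i _|h i]; exact: h.
apply: fin_bigcap_measurable => // i _; rewrite -[X in measurable X]setTI.
exact: (@measurable_coord _ R n i).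
Qed.

Lemma measurable_rat_cube q k : measurable (rat_cube q k).
Proof.
apply: (@measurable_cube (fun i => [set t | `|t - ratr (q ord0 i)| < k.+1%:R^-1])).
move=> i; rewrite (_ : [set _ | _] = [set` `]ratr (q ord0 i) - k.+1%:R^-1,
  ratr (q ord0 i) + k.+1%:R^-1[ ]); first exact: measurable_itv.
by apply/funext => t; rewrite /= in_itv/= ltr_distl.
Qed.

Lemma rat_cube_nbhs (x : Rn) (A : set Rn) : nbhs x A ->
  exists q k, rat_cube q k x /\ rat_cube q k `<=` A.
Proof.
move=> /nbhs_ballP[d /= d0 dA].
have [k kd] : exists k : nat, k.+1%:R^-1 < d / 2.
  have := near_infty_natSinv_lt (PosNum (divr_gt0 d0 (ltr0Sn R 1))).
  by move=> [k _ /(_ k (leqnn k)) /= ?]; exists k.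
have k0 : 0 < k.+1%:R^-1 :> R by rewrite invr_gt0.
have /choice[f hf] : forall i, exists q : rat, `|x ord0 i - ratr q| < k.+1%:R^-1.
  by move=> i; exact: rat_approx.
exists (\row_i f i), k; split=> [i|y hy]; first by rewrite mxE.
apply: dA; rewrite mx_norm_ball /ball_/= /Num.Def.normr/= mx_normrE.
apply: bigmax_lt => //= -[i j] _; rewrite !mxE (ord1 i) {i}/=.
have := hy j; rewrite mxE => hyj; have hxj := hf j.
have := ler_distD (ratr (f j)) (x ord0 j) (y ord0 j).
rewrite (distrC (ratr _)) => h; apply: le_lt_trans h _.
by rewrite (splitr d) ltrD// (lt_trans _ kd).
Qed.

Lemma open_measurable_rV (U : set Rn) : open U -> measurable U.
Proof.
move=> oU; pose P (qk : 'rV[rat]_n * nat) := rat_cube qk.1 qk.2 `<=` U.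
rewrite (_ : U = \bigcup_(qk : 'rV[rat]_n * nat)
    (if pselect (P qk) then rat_cube qk.1 qk.2 else set0)).
  apply: countable_bigcupT_measurable => [|[q k]]; first exact: countableP.
  by rewrite /=; case: pselect => [?|?]; [exact: measurable_rat_cube|exact: measurable0].
apply/seteqP; split=> x; last by move=> [[q k] _]; case: pselect => // qU /qU.
move=> Ux; have [q [k [qx qU]]] := rat_cube_nbhs (open_nbhs_nbhs (conj oU Ux)).
by exists (q, k) => //; case: pselect.
Qed.

Lemma continuous_measurable_rV (f : Rn -> R) :
  continuous f -> measurable_fun [set: Rn] f.
Proof.
move=> /continuousP cf; apply: (measurability _ (RGenOpens.measurableE R)).
move=> _ [_ [a [b ->] <-]]; rewrite setTI.
by apply: open_measurable_rV; apply: cf; exact: interval_open.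
Qed.

End borel_rV.

(** * Integration by parts in R^n *)
Section integral_partial.
Context {R : realType}.

Lemma integrable_bounded_support d (T : measurableType d)
    (mu : {measure set T -> \bar R}) (A : set T) (C : R) (f : T -> R) :
  measurable A -> (mu A < +oo)%E -> measurable_fun setT f ->
  (forall x, `|f x| <= C) -> (forall x, f x != 0 -> A x) ->
  mu.-integrable setT (EFin \o f).
Proof.
move=> mA Afin mf fC fA.
rewrite (_ : EFin \o f = (EFin \o f) \_ A).
  apply/(integrable_mkcond _ mA)/measurable_bounded_integrable => //.
    exact: measurable_funTS.
  exists C; split; first exact: num_real.
  by move=> M CM x _ /=; rewrite (le_trans (fC x))// ltW.
apply/funext => x; rewrite /patch; case: ifPn => //= xA; congr EFin.
by apply/eqP; apply: contraNT xA => /fA ?; rewrite inE.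
Qed.

Lemma integral_compact_derivative (f h : R -> R) (M : R) :
  continuous h -> (forall t, is_derive t (1 : R) f (h t)) ->
  (forall t, M <= `|t| -> f t = 0 /\ h t = 0) ->
  (\int[lebesgue_measure]_t (h t)%:E = 0)%E.
Proof.
move=> ch dfh fM; pose N := `|M| + 1.
have N0 : 0 < N by rewrite ltr_wpDl.
have MN : M <= N by rewrite (le_trans (ler_norm _))// lerDl.
have hN t : `[- N, N]%classic t \/ h t = 0.
  have [tN|tN] := leP `|t| N; [left|right].
    by rewrite /= in_itv/= -ler_norml.
  by have [] := fM t (le_trans MN (ltW tN)).
have df t : derivable f t 1 by have [] := dfh t.
have cf : continuous f.
  by move=> t; exact/differentiable_continuous/derivable1_diffP.
transitivity (\int[lebesgue_measure]_(t in `[(- N)%R, N]) (h t)%:E)%E.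
  rewrite [RHS]integral_mkcond; apply: eq_integral => t _; rewrite /patch.
  case: ifPn => // tN; have [tN'|->//] := hN t.
  by move: tN; rewrite notin_setE.
rewrite (@continuous_FTC2 _ h f).
- have [fN _] := fM N (le_trans MN (ler_norm _)).
  have [fN' _] : f (- N) = 0 /\ h (- N) = 0.
    by apply: fM; rewrite normrN (le_trans MN (ler_norm _)).
  by rewrite fN fN' sube0.
- by rewrite gtrN.
- exact: continuous_subspaceT.
- split; first by move=> t _; exact: df.
  + by apply: cvg_at_right_filter; exact: cf.
  + by apply: cvg_at_left_filter; exact: cf.
- by move=> t _; rewrite derive1E; have [] := dfh t.
Qed.

(** Directional derivatives are transported by a map sending a line to a
    line. *)
Lemma is_derive_along (V W : normedModType R) (F : W -> R) (g : V -> W)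
    (v x : V) (w : W) (d : R) :
  (forall h : R, g (h *: v + x) = h *: w + g x) ->
  is_derive (g x) w F d -> is_derive x v (F \o g) d.
Proof.
move=> gv; have E : (fun h : R => h^-1 *: ((F \o g) (h *: v + x) - (F \o g) x)) =
    (fun h : R => h^-1 *: (F (h *: w + g x) - F (g x))).
  by apply/funext => h /=; rewrite gv.
by case=> dF DF; split; move: dF DF; rewrite /derivable /derive -E.
Qed.

Section consrV.
Variable n : nat.
Implicit Types (p : R * 'rV[R]_n) (i : 'I_n).

Lemma consrV0 p : @consrV R n p ord0 ord0 = p.1.
Proof.
have -> : (ord0 : 'I_n.+1) = @lshift 1 n ord0 by exact: val_inj.
by rewrite /consrV (@row_mxEl _ 1 1 n) mxE.
Qed.

Lemma consrVS p i : @consrV R n p ord0 (lift ord0 i) = p.2 ord0 i.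
Proof.
have -> : lift ord0 i = @rshift 1 n i by exact: val_inj.
by rewrite /consrV (@row_mxEr _ 1 1 n).
Qed.

Lemma consrV_line0 (t h : R) (y : 'rV[R]_n) :
  @consrV R n (h *: (1 : R) + t, y) = h *: delta_mx ord0 ord0 + consrV (t, y).
Proof.
apply/rowP => i; rewrite [RHS]mxE; case: (unliftP ord0 i) => [j ->|->].
  by rewrite !consrVS !mxE /= mulr0 add0r.
by rewrite !consrV0 !mxE.
Qed.

Lemma consrV_lineS (t h : R) (y : 'rV[R]_n) j :
  @consrV R n (t, h *: delta_mx ord0 j + y) =
  h *: delta_mx ord0 (lift ord0 j) + consrV (t, y).
Proof.
apply/rowP => i; rewrite [RHS]mxE; case: (unliftP ord0 i) => [k ->|->].
  by rewrite !consrVS !mxE /= (inj_eq lift_inj).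
by rewrite !consrV0 !mxE /= mulr0 add0r.
Qed.

Lemma continuous_consrV0 (y : 'rV[R]_n) :
  continuous (fun t : R => @consrV R n (t, y)).
Proof.
apply: continuous_rV => i; case: (unliftP ord0 i) => [k ->|->].
  by under eq_fun do rewrite consrVS; move=> t; exact: cvg_cst.
by under eq_fun do rewrite consrV0; move=> t; exact: cvg_id.
Qed.

Lemma continuous_consrVS (t : R) :
  continuous (fun y : 'rV[R]_n => @consrV R n (t, y)).
Proof.
apply: continuous_rV => i; case: (unliftP ord0 i) => [k ->|->].
  by under eq_fun do rewrite consrVS; exact: coord_continuous.
by under eq_fun do rewrite consrV0; exact: cst_continuous.
Qed.

End consrV.

Lemma lebesgue_rV_cube n (a b : R) : a <= b ->
  lebesgue_rV n [set x : 'rV[R]_n | forall j, x ord0 j \in `[a, b]] =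
  ((b - a) ^+ n)%:E.
Proof.
move=> ab; transitivity (\prod_(i < n)
    ((const_mx b : 'rV[R]_n) ord0 i - (const_mx a : 'rV[R]_n) ord0 i))%:E.
  rewrite -lebesgue_rV_box; last by move=> i; rewrite !mxE.
  congr (lebesgue_rV n _).
  by apply/seteqP; split=> x h j; have := h j; rewrite !mxE.
congr EFin; under eq_bigr do rewrite !mxE.
by rewrite prodr_const card_ord.
Qed.

(** The integral of a partial derivative of a compactly supported function is
    zero.  By induction on the dimension: the first coordinate is handled by the
    fundamental theorem of calculus, the others by the induction hypothesis on
    each slice, and Fubini's theorem concludes in both cases. *)
Lemma integral_partial_derivative n (i : 'I_n) (F H : 'rV[R]_n -> R) (M : R) :
  continuous H -> (forall x, is_derive x (delta_mx ord0 i) F (H x)) ->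
  (forall x : 'rV[R]_n, (exists j, M <= `|x ord0 j|) -> F x = 0 /\ H x = 0) ->
  (\int[lebesgue_rV n]_x (H x)%:E = 0)%E.
Proof.
elim: n i F H => [[]//|n ih] i F H cH dF FM.
pose cube : set 'rV[R]_n.+1 := [set x | forall j, x ord0 j \in `[- `|M|, `|M|]].
have supp x : H x != 0 -> cube x.
  apply: contra_neqP => /existsNP[j xj].
  have Mx : M <= `|x ord0 j|.
    rewrite leNgt; apply/negP => h; apply: xj.
    by rewrite in_itv/= -ler_norml (le_trans (ltW h))// ler_norm.
  by have [] := FM x (ex_intro _ j Mx).
have ccube : compact cube.
  apply: (@rV_compact _ _ (fun=> `[- `|M|, `|M|]%classic)) => _.
  exact: segment_compact.
have [C C0 HC] := compact_support_bounded ccube cH supp.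
have mcube : measurable cube.
  apply: (@measurable_cube _ _ (fun=> `[- `|M|, `|M|]%classic)) => _.
  exact: measurable_itv.
have cubefin : (lebesgue_rV n.+1 cube < +oo)%E.
  by rewrite /cube lebesgue_rV_cube ?ltry// (le_trans _ (normr_ge0 M))// oppr_le0.
have mH : measurable_fun setT H by exact: continuous_measurable_rV.
have mC : measurable_fun setT (@consrV R n) by exact: measurable_consrV.
have iH : (lebesgue_measure \x lebesgue_rV n)%E.-integrable setT
    (EFin \o (H \o @consrV R n)).
  apply: (@integrable_bounded_support _ _ _ (@consrV R n @^-1` cube) C) => //.
  - by rewrite -[X in measurable X]setTI; exact: mC.
  - exact: measurableT_comp.
  - by move=> p; exact: HC.
  - by move=> p; exact: supp.
rewrite /= /lebesgue_step integral_pushforward//=.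
- rewrite preimage_setT; case: (unliftP ord0 i) => [j|] ij.
    rewrite -(integral12_prod_meas1 iH) integral0_eq// => t _ /=.
    apply: (ih j (F \o (fun y => consrV (t, y)))).
    + by move=> y; apply: (@continuous_comp _ _ _ (fun y => consrV (t, y)) H);
        [exact: continuous_consrVS|exact: cH].
    + move=> y; apply: (is_derive_along (fun h => consrV_lineS t h y j)).
      by rewrite -ij; exact: dF.
    + move=> y [k yk]; apply: FM; exists (lift ord0 k).
      by rewrite consrVS.
  rewrite -(integral21_prod_meas1 iH) integral0_eq// => y _ /=.
  apply: (@integral_compact_derivative (F \o (fun t => consrV (t, y))) _ M).
  + by move=> t; apply: (@continuous_comp _ _ _ (fun t => consrV (t, y)) H);
        [exact: continuous_consrV0|exact: cH].
  + move=> t; apply: (is_derive_along (fun h => consrV_line0 t h y)).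
    by rewrite -ij; exact: dF.
  + by move=> t tM; apply: FM; exists ord0; rewrite consrV0.
- exact/measurable_EFinP.
Qed.

End integral_partial.

(** * The L^2 pairing of fields *)
Section energy.
Context {R : realType} {n : nat}.
Local Notation Rn := 'rV[R]_n.
Local Notation mu := (@lebesgue_rV R n).
Implicit Types (f g : Rn -> Rn).

(** The square of the [L^2] norm. *)
Definition energy f : \bar R := (\int[mu]_x (enorm (f x) ^+ 2)%:E)%E.

(** The Euclidean inner product. *)
Definition dot (a b : Rn) : R := \sum_(i < n) a ord0 i * b ord0 i.

Lemma dotDl (a b c : Rn) : dot (a + b) c = dot a c + dot b c.
Proof. by rewrite /dot -big_split; apply: eq_bigr => i _; rewrite mxE mulrDl. Qed.

Lemma dotZl (s : R) (a c : Rn) : dot (s *: a) c = s * dot a c.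
Proof. by rewrite /dot mulr_sumr; apply: eq_bigr => i _; rewrite mxE mulrA. Qed.

Lemma dot_sqr (a : Rn) : dot a a = enorm a ^+ 2.
Proof. by rewrite enorm_sqr; apply: eq_bigr => i _; rewrite expr2. Qed.

Lemma dot_le (t : R) (a b : Rn) : 0 < t ->
  `|dot a b| <= (t * enorm a ^+ 2 + t^-1 * enorm b ^+ 2) / 2.
Proof.
move=> t0; rewrite (le_trans (ler_norm_sum _ _ _))// !enorm_sqr !mulr_sumr.
rewrite -big_split/= mulr_suml; apply: ler_sum => i _.
move: (a ord0 i) (b ord0 i) => x y.
rewrite ler_norml; apply/andP; split; rewrite -subr_ge0.
  have -> : x * y - - ((t * x ^+ 2 + t^-1 * y ^+ 2) / 2) =
    t^-1 * (t * x + y) ^+ 2 / 2 by field; rewrite gt_eqF.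
  by rewrite divr_ge0// mulr_ge0 ?sqr_ge0// invr_ge0 ltW.
have -> : (t * x ^+ 2 + t^-1 * y ^+ 2) / 2 - x * y =
  t^-1 * (t * x - y) ^+ 2 / 2 by field; rewrite gt_eqF.
by rewrite divr_ge0// mulr_ge0 ?sqr_ge0// invr_ge0 ltW.
Qed.

Lemma enormD_sqr_le (a b : Rn) :
  enorm (a + b) ^+ 2 <= 2 * enorm a ^+ 2 + 2 * enorm b ^+ 2.
Proof.
rewrite !enorm_sqr !mulr_sumr -big_split/=; apply: ler_sum => i _.
rewrite mxE -subr_ge0; move: (a ord0 i) (b ord0 i) => x y.
have -> : 2 * x ^+ 2 + 2 * y ^+ 2 - (x + y) ^+ 2 = (x - y) ^+ 2 by ring.
exact: sqr_ge0.
Qed.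

Lemma enormZ_sqr (s : R) (a : Rn) : enorm (s *: a) ^+ 2 = s ^+ 2 * enorm a ^+ 2.
Proof.
by rewrite !enorm_sqr mulr_sumr; apply: eq_bigr => i _; rewrite mxE exprMn.
Qed.

Lemma measurable_dot f g : measurable_fun setT f -> measurable_fun setT g ->
  measurable_fun setT (fun x => dot (f x) (g x)).
Proof.
move=> /measurable_fun_rVP mf /measurable_fun_rVP mg.
by apply: measurable_sum => i; apply: measurable_funM; [exact: mf|exact: mg].
Qed.

Lemma measurable_enorm_sqr f : measurable_fun setT f ->
  measurable_fun setT (fun x => enorm (f x) ^+ 2).
Proof. by move=> mf; apply: measurable_funX; exact: measurable_enorm. Qed.

Lemma energy_ge0 f : (0 <= energy f)%E.
Proof. by apply: integral_ge0 => x _; rewrite lee_fin sqr_ge0. Qed.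

Lemma energyK f : (energy f < +oo)%E -> (fine (energy f))%:E = energy f.
Proof. by move=> foo; rewrite fineK// ge0_fin_numE// energy_ge0. Qed.

Lemma fine_energy_ge0 f : 0 <= fine (energy f).
Proof. by rewrite fine_ge0// energy_ge0. Qed.

Lemma integrable_enorm_sqr f : measurable_fun setT f -> (energy f < +oo)%E ->
  mu.-integrable setT (fun x => (enorm (f x) ^+ 2)%:E).
Proof.
move=> mf foo; apply/integrableP; split.
  by apply/measurable_EFinP; exact: measurable_enorm_sqr.
rewrite (le_lt_trans _ foo)//.
by under eq_integral do rewrite gee0_abs ?lee_fin ?sqr_ge0//.
Qed.

Lemma integrable_dot f g : measurable_fun setT f -> measurable_fun setT g ->
  (energy f < +oo)%E -> (energy g < +oo)%E ->
  mu.-integrable setT (fun x => (dot (f x) (g x))%:E).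
Proof.
move=> mf mg foo goo.
apply: (@le_integrable _ _ _ mu setT measurableT _
  (fun x => (enorm (f x) ^+ 2)%:E + (enorm (g x) ^+ 2)%:E)%E).
- by apply/measurable_EFinP; exact: measurable_dot.
- move=> x _; rewrite -EFinD !abse_EFin lee_fin.
  rewrite (le_trans (dot_le (f x) (g x) ltr01))// invr1 !mul1r.
  have := sqr_ge0 (enorm (f x)); have := sqr_ge0 (enorm (g x)).
  by move=> ? ?; rewrite ger0_norm ?addr_ge0// ler_pdivrMr// ler_peMr ?addr_ge0// ler1n.
- by apply: integrableD => //; exact: integrable_enorm_sqr.
Qed.

(** The [L^2] inner product, as a real number; it is meaningful for measurable
    fields of finite energy. *)
Definition pairing f g : R := \int[mu]_x dot (f x) (g x).

Lemma pairingE f g : measurable_fun setT f -> measurable_fun setT g ->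
  (energy f < +oo)%E -> (energy g < +oo)%E ->
  (pairing f g)%:E = (\int[mu]_x (dot (f x) (g x))%:E)%E.
Proof.
move=> mf mg foo goo; rewrite /pairing /Rintegral fineK//.
exact/integrable_fin_num/integrable_dot.
Qed.

Lemma pairing_self f : pairing f f = fine (energy f).
Proof. by rewrite /pairing; under eq_Rintegral do rewrite dot_sqr. Qed.

Lemma integrable_scale (k : R) (h : Rn -> R) :
  mu.-integrable setT (EFin \o h) ->
  mu.-integrable setT (EFin \o (fun x => k * h x)).
Proof.
by move=> hi; apply: (eq_integrable measurableT _ _ _ (integrableZl measurableT k hi)).
Qed.

Lemma integrable_add (h k : Rn -> R) :
  mu.-integrable setT (EFin \o h) -> mu.-integrable setT (EFin \o k) ->
  mu.-integrable setT (EFin \o (fun x => h x + k x)).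
Proof.
by move=> hi ki; apply: (eq_integrable measurableT _ _ _ (integrableD measurableT hi ki)).
Qed.

(** The weighted form of the Cauchy-Schwarz inequality. *)
Lemma pairing_le (t : R) f g : 0 < t ->
  measurable_fun setT f -> measurable_fun setT g ->
  (energy f < +oo)%E -> (energy g < +oo)%E ->
  `|pairing f g| <= (t * fine (energy f) + t^-1 * fine (energy g)) / 2.
Proof.
move=> t0 mf mg foo goo.
have fi := integrable_enorm_sqr mf foo; have gi := integrable_enorm_sqr mg goo.
have fgi := integrable_dot mf mg foo goo.
rewrite (le_trans (le_normr_Rintegral measurableT fgi))//.
have -> : (t * fine (energy f) + t^-1 * fine (energy g)) / 2 =
    \int[mu]_x (t / 2 * enorm (f x) ^+ 2 + t^-1 / 2 * enorm (g x) ^+ 2).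
  rewrite RintegralD//; [|exact: integrable_scale..].
  by rewrite !RintegralZl// /Rintegral -/(energy f) -/(energy g); ring.
apply: le_Rintegral => //.
- exact: (integrable_norm fgi).
- by apply: integrable_add; exact: integrable_scale.
- move=> x _; rewrite (le_trans (dot_le _ _ t0))//.
  by rewrite mulrDl (mulrAC t) (mulrAC t^-1).
Qed.

Lemma pairingD f f' g : measurable_fun setT f -> measurable_fun setT f' ->
  measurable_fun setT g ->
  (energy f < +oo)%E -> (energy f' < +oo)%E -> (energy g < +oo)%E ->
  pairing (fun x => f x + f' x) g = pairing f g + pairing f' g.
Proof.
move=> mf mf' mg foo foo' goo; rewrite /pairing -RintegralD//.
- by apply: eq_Rintegral => x _; rewrite dotDl.
- exact: integrable_dot.
- exact: integrable_dot.
Qed.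

Lemma pairingZ (s : R) f g : measurable_fun setT f -> measurable_fun setT g ->
  (energy f < +oo)%E -> (energy g < +oo)%E ->
  pairing (fun x => s *: f x) g = s * pairing f g.
Proof.
move=> mf mg foo goo; rewrite /pairing -RintegralZl//; last exact: integrable_dot.
by apply: eq_Rintegral => x _; rewrite dotZl.
Qed.

Lemma measurable_addrV f g : measurable_fun setT f -> measurable_fun setT g ->
  measurable_fun setT (fun x => f x + g x).
Proof.
move=> /measurable_fun_rVP mf /measurable_fun_rVP mg.
apply/measurable_fun_rVP => i; under eq_fun do rewrite !mxE.
exact: measurable_funD.
Qed.

Lemma measurable_scalerV (s : R) f : measurable_fun setT f ->
  measurable_fun setT (fun x => s *: f x).
Proof.
move=> /measurable_fun_rVP mf.
apply/measurable_fun_rVP => i; under eq_fun do rewrite !mxE.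
exact: measurable_funM.
Qed.

Lemma energyD_le f g : measurable_fun setT f -> measurable_fun setT g ->
  (energy (fun x => (f x + g x)%R) <= 2%:E * energy f + 2%:E * energy g)%E.
Proof.
move=> mf mg; have mf2 := measurable_enorm_sqr mf.
have mg2 := measurable_enorm_sqr mg.
have mZ (h : Rn -> Rn) : measurable_fun setT (fun x => enorm (h x) ^+ 2) ->
    measurable_fun setT (fun x => (2 * enorm (h x) ^+ 2)%:E).
  by move=> mh; apply/measurable_EFinP; exact: measurable_funM.
have Z (h : Rn -> Rn) : measurable_fun setT (fun x => enorm (h x) ^+ 2) ->
    (\int[mu]_x (2 * enorm (h x) ^+ 2)%:E = 2%:E * energy h)%E.
  move=> mh; under eq_integral do rewrite EFinM.
  rewrite ge0_integralZl_EFin//; first by move=> x _; rewrite lee_fin sqr_ge0.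
  exact/measurable_EFinP.
rewrite -(Z f mf2) -(Z g mg2) -ge0_integralD//; first last.
- exact: mZ.
- by move=> x _; rewrite lee_fin mulr_ge0 ?sqr_ge0.
- exact: mZ.
- by move=> x _; rewrite lee_fin mulr_ge0 ?sqr_ge0.
apply: ge0_le_integral => //.
- by move=> x _; rewrite lee_fin sqr_ge0.
- apply/measurable_EFinP; apply: (@measurable_enorm_sqr (fun x => f x + g x)).
  exact: measurable_addrV.
- by apply: emeasurable_funD; exact: mZ.
- by move=> x _; rewrite -EFinD lee_fin; exact: enormD_sqr_le.
Qed.

Lemma energyZ (s : R) f : measurable_fun setT f ->
  energy (fun x => s *: f x) = ((s ^+ 2)%:E * energy f)%E.
Proof.
move=> mf; rewrite /energy -ge0_integralZl_EFin ?sqr_ge0//.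
- by apply: eq_integral => x _; rewrite enormZ_sqr EFinM.
- by move=> x _; rewrite lee_fin sqr_ge0.
- by apply/measurable_EFinP; exact: measurable_enorm_sqr.
Qed.

Lemma L2normE f : L2norm f = (energy f `^ 2^-1)%E.
Proof.
rewrite /L2norm unlock /energy; congr (_ `^ _)%E; apply: eq_integral => x _ /=.
by rewrite ger0_norm ?enorm_ge0// (powR_mulrn 2 (enorm_ge0 _)).
Qed.

End energy.

(** * Weakly divergence-free fields *)
Section fields.
Context {R : realType} {n : nat}.
Local Notation Rn := 'rV[R]_n.
Local Notation mu := (@lebesgue_rV R n).
Implicit Types (f g : Rn -> Rn).

(** The closed cube of half-width [M >= 0] centred at 0. *)
Definition cube (M : R) : set Rn := [set x | forall j, x ord0 j \in `[- M, M]].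

Lemma measurable_cube_sym M : measurable (cube M).
Proof.
apply: (@measurable_cube _ _ (fun=> `[- M, M]%classic)) => _.
exact: measurable_itv.
Qed.

Lemma cube_fin M : (mu (cube M) < +oo)%E.
Proof.
have [M0|M0] := leP 0 M.
  by rewrite lebesgue_rV_cube ?ltry// (le_trans _ M0)// oppr_le0.
apply: (@le_lt_trans _ _ (mu (cube 0))).
  apply: le_measure; rewrite ?inE; [exact: measurable_cube_sym..|].
  move=> x xM j; have := xM j; rewrite !in_itv/= => /andP[h1 h2].
  by exfalso; move: h1 h2 M0; lra.
by rewrite lebesgue_rV_cube ?ltry// oppr0.
Qed.

Lemma compact_cube M : compact (cube M).
Proof.
apply: (@rV_compact _ _ (fun=> `[- M, M]%classic)) => _; exact: segment_compact.
Qed.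

Lemma integrable_continuous_cube (h : Rn -> R) M : continuous h ->
  (forall x, h x != 0 -> cube M x) -> mu.-integrable setT (EFin \o h).
Proof.
move=> ch hM; have [C C0 hC] := compact_support_bounded (@compact_cube M) ch hM.
apply: (integrable_bounded_support (measurable_cube_sym M) (cube_fin M)) hC hM.
exact: continuous_measurable_rV.
Qed.

Lemma continuous_coord f i : continuous f -> continuous (fun x => f x ord0 i).
Proof.
move=> cf x; apply: (@continuous_comp _ _ _ f (fun y : Rn => y ord0 i)).
  exact: cf.
exact: coord_continuous.
Qed.

Lemma continuous_measurable_field f : continuous f -> measurable_fun setT f.
Proof.
move=> cf; apply/measurable_fun_rVP => i; apply: continuous_measurable_rV.
exact: continuous_coord.
Qed.

Lemma energy_fin_cube f M : continuous f ->
  (forall x, f x != 0 -> cube M x) -> (energy f < +oo)%E.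
Proof.
move=> cf fM; have ci i : continuous (fun x => f x ord0 i) by exact: continuous_coord.
have hi : mu.-integrable setT (EFin \o (fun x => enorm (f x) ^+ 2)).
  apply: (@integrable_continuous_cube _ M).
    rewrite (_ : (fun x => _) = fun x => \sum_(i < n) f x ord0 i * f x ord0 i).
      elim: (index_enum _) => [|i s ih].
        by under eq_fun do rewrite big_nil; exact: cst_continuous.
      under eq_fun do rewrite big_cons.
      by move=> x; exact: (cvgD (cvgM (ci i x) (ci i x)) (ih x)).
    apply/funext => x; rewrite enorm_sqr.
    by apply: eq_bigr => i _; rewrite expr2.
  move=> x; have [fx0|/fM//] := eqVneq (f x) 0.
  rewrite fx0 enorm_sqr big1 ?eqxx// => i _.
  by rewrite mxE expr0n.
have := integrable_fin_num measurableT hi; rewrite ge0_fin_numE//.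
exact: energy_ge0.
Qed.

Lemma compact_sub_cube (K : set Rn) : compact K -> exists M, K `<=` cube M.
Proof.
move=> /compact_bounded/ex_strict_bound_gt0[M M0 KM]; exists M => x Kx j.
by rewrite in_itv/= -ler_norml (le_trans (ler_mx_norm _ _))// ltW// KM.
Qed.

(** The gradient, as a field. *)
Definition grad (psi : Rn -> R) (x : Rn) : Rn :=
  \row_i 'D_(delta_mx ord0 i) psi x.

Lemma test_function_cube (W : normedModType R) (psi : Rn -> W) :
  test_function psi -> exists M, forall v x,
    (psi x != 0 -> cube M x) /\ ('D_v psi x != 0 -> cube M x).
Proof.
move=> [_ cpsi]; have [M KM] := compact_sub_cube cpsi; exists M => v x; split.
  by move=> px; apply: KM; exact: subset_closure.
move=> px; apply: KM; move: px; apply: derive_closed_support.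
  exact: closed_closure.
by move=> q pq; exact: (@subset_closure _ [set x | psi x != 0]).
Qed.

Lemma continuous_grad psi : test_function psi -> continuous (grad psi).
Proof.
move=> [spsi _]; apply: continuous_rV => i; under eq_fun do rewrite mxE.
exact: (spsi [:: _]).1.
Qed.

Lemma energy_grad_fin psi : test_function psi -> (energy (grad psi) < +oo)%E.
Proof.
move=> tpsi; have [M hM] := test_function_cube tpsi.
apply: (@energy_fin_cube _ M); first exact: continuous_grad.
move=> x; apply: contra_neqP => xM; apply/rowP => i; rewrite !mxE.
by apply/eqP; apply: contra_notT xM; exact: (hM _ _).2.
Qed.

Lemma weak_div_freeP f : measurable_fun setT f -> (energy f < +oo)%E ->
  weak_div_free f <-> (forall psi, test_function psi -> pairing f (grad psi) = 0).
Proof.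
move=> mf foo; split=> h psi tpsi; have := h psi tpsi.
  rewrite /pairing /Rintegral => {}h; rewrite -[RHS]/(fine 0%E) -h.
  by congr fine; apply: eq_integral => x _; congr EFin; apply: eq_bigr => i _;
    rewrite mxE.
move=> {}h; have := pairingE mf (continuous_measurable_field (continuous_grad tpsi))
  foo (energy_grad_fin tpsi).
rewrite h => h0; rewrite -[RHS]/(0%:E) h0; apply: eq_integral => x _.
by congr EFin; apply: eq_bigr => i _; rewrite mxE.
Qed.

(** Classical divergence-freeness implies the weak one: [f . grad psi] is the
    sum of the partial derivatives of the [f_i psi], each of integral zero. *)
Lemma div_free_weak f (df : 'I_n -> Rn -> R) M :
  continuous f -> (forall i, continuous (df i)) ->
  (forall i x, is_derive x (delta_mx ord0 i : Rn) (fun x => f x ord0 i) (df i x)) ->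
  (forall x, \sum_i df i x = 0) ->
  (forall x, f x != 0 -> cube M x) -> weak_div_free f.
Proof.
move=> cf cdf fdf div0 fM psi tpsi.
have [spsi cpsi] := tpsi.
have cM : closed (cube M).
  by apply: compact_closed; [exact: norm_hausdorff|exact: compact_cube].
have fiM i x : f x ord0 i != 0 -> cube M x.
  by move=> fx; apply: fM; apply: contra_neq fx => ->; rewrite mxE.
have dfM i x : df i x != 0 -> cube M x.
  have [_ <-] := fdf i x; apply: derive_closed_support => // q; exact: fiM.
pose H i x := f x ord0 i * 'D_(delta_mx ord0 i) psi x + psi x * df i x.
have HM i x : H i x != 0 -> cube M x.
  apply: contra_neqP => xM; rewrite /H.
  have -> : f x ord0 i = 0 by apply/eqP; apply: contra_notT xM; exact: fiM.
  have -> : df i x = 0 by apply/eqP; apply: contra_notT xM; exact: dfM.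
  by rewrite mul0r mulr0 addr0.
have cH i : continuous (H i).
  have ci : continuous (fun x => f x ord0 i) by exact: continuous_coord.
  move=> x; apply: (cvgD (cvgM (ci x) _) (cvgM _ (cdf i x))).
    exact: (spsi [:: delta_mx ord0 i]).1.
  exact: (spsi [::]).1.
have H0 i : (\int[mu]_x (H i x)%:E = 0)%E.
  apply: (@integral_partial_derivative R n i (fun x => f x ord0 i * psi x) _ (M + 1)).
  - exact: cH.
  - move=> x; have dpsi : is_derive x (delta_mx ord0 i : Rn) psi
      ('D_(delta_mx ord0 i) psi x) by apply/derivableP; exact: (spsi [::]).2.
    exact: (is_deriveM (fdf i x) dpsi).
  - move=> x [j xj]; have xM : ~ cube M x.
      move=> /(_ j); rewrite in_itv/= -ler_norml => h.
      by move: (le_trans xj h); lra.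
    split; last by apply/eqP; apply: contra_notT xM; exact: HM.
    by rewrite (_ : f x = 0) ?mxE ?mul0r//; apply/eqP; apply: contra_notT xM; exact: fM.
transitivity (\int[mu]_x (\sum_(i < n) (H i x)%:E))%E.
  apply: eq_integral => x _; rewrite sumEFin /H big_split/= -mulr_sumr div0.
  by rewrite mulr0 addr0.
rewrite integral_sum//; last first.
  by move=> i; apply: (@integrable_continuous_cube _ M) => //; exact: HM.
by rewrite big1.
Qed.

End fields.

(** * The metric space of divergence-free fields *)
Section L2sigma_facts.
Context {R : realType} {n : nat}.
Local Notation Rn := 'rV[R]_n.
Local Notation mu := (@lebesgue_rV R n).
Implicit Types (f g : Rn -> Rn) (u v : @L2sigma R n).

Lemma L2norm_fin f : (L2norm f < +oo)%E <-> (energy f < +oo)%E.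
Proof.
rewrite L2normE; split; last exact: poweR_lty.
by case: (energy f) => [r||]//; rewrite ?ltry// poweRyr ?invr_eq0.
Qed.

Lemma L2sigma_energy u : (energy u < +oo)%E.
Proof. exact/L2norm_fin/L2sigma_fin. Qed.

Lemma L2sigma_dist_energy u v : (energy (fun x => u x - v x)%R < +oo)%E ->
  L2sigma_dist u v = Num.sqrt (fine (energy (fun x => u x - v x))).
Proof.
move=> foo; rewrite /L2sigma_dist L2normE -energyK//= powR12_sqrt//.
exact: fine_energy_ge0.
Qed.

Lemma energyB_fin f g : measurable_fun setT f -> measurable_fun setT g ->
  (energy f < +oo)%E -> (energy g < +oo)%E ->
  (energy (fun x => f x - g x)%R < +oo)%E.
Proof.
move=> mf mg foo goo.
have mg' := measurable_scalerV (-1) mg.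
rewrite (_ : (fun x => _) = fun x => f x + -1 *: g x); last first.
  by apply/funext => x; rewrite scaleN1r.
rewrite (le_lt_trans (energyD_le mf mg'))// energyZ// -(energyK foo) -(energyK goo).
by rewrite -!EFinM -EFinD ltry.
Qed.

Lemma ball_energy u v (e : R) : 0 < e ->
  ball u e v <-> fine (energy (fun x => u x - v x)) < e ^+ 2.
Proof.
move=> e0; have foo : (energy (fun x => u x - v x)%R < +oo)%E.
  by apply: energyB_fin; [exact: measurable_L2sigma|exact: measurable_L2sigma|
    exact: L2sigma_energy|exact: L2sigma_energy].
have -> : ball u e v = (L2sigma_dist u v < e) by [].
rewrite L2sigma_dist_energy// -[X in _ < X](ger0_norm (ltW e0)) -sqrtr_sqr.
by rewrite ltr_sqrt// exprn_gt0.
Qed.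

(** Elements of [L2sigma] are classes of fields modulo null sets, seen as
    functions through a representative: the field [f] is only recovered almost
    everywhere. *)
Lemma L2sigma_of f : measurable_fun setT f -> (energy f < +oo)%E ->
  weak_div_free f -> exists u : @L2sigma R n, {ae mu, forall x, u x = f x}.
Proof.
move=> mf foo df.
pose mixin := isMeasurableFun.Build _ _ _ _ _ mf.
pose F : {mfun Rn >-> Rn} := MeasurableFun.Pack (MeasurableFun.Class mixin).
pose w : {mfun_ mu, Rn >-> Rn} := (\pi_({mfun_ mu, Rn >-> Rn}) F)%qT.
have wf : {ae mu, forall x, w x = f x}.
  have : (repr w = F %[mod {mfun_ mu, Rn >-> Rn}])%qT by rewrite reprK.
  move=> /eqP; rewrite eqmodE => /asboolP.
  by apply: filterS => x /(_ I).
have mw : measurable_fun setT w by exact: measurable_funP.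
have we : energy w = energy f.
  apply: ae_eq_integral => //.
  - by apply/measurable_EFinP; exact: measurable_enorm_sqr.
  - by apply/measurable_EFinP; exact: measurable_enorm_sqr.
  - by apply: filterS wf => x -> _.
have w1 : (L2norm w < +oo)%E by apply/L2norm_fin; rewrite we.
have w2 : weak_div_free w.
  move=> psi tpsi; rewrite -[RHS](df psi tpsi).
  have mg := continuous_measurable_field (continuous_grad tpsi).
  have mdot (g : Rn -> Rn) : measurable_fun setT g -> measurable_fun setT
      (fun x => (\sum_(i < n) g x ord0 i * 'D_(delta_mx ord0 i) psi x)%:E).
    move=> mg'; apply/measurable_EFinP; have := measurable_dot mg' mg.
    apply: eq_measurable_fun => x _; rewrite /dot.
    by apply: eq_bigr => i _; rewrite mxE.
  apply: ae_eq_integral => //; [exact: mdot|exact: mdot|].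
  by apply: filterS wf => x -> _.
by exists (MkL2sigma w1 w2).
Qed.

Lemma energy_ae f g : measurable_fun setT f -> measurable_fun setT g ->
  {ae mu, forall x, f x = g x} -> energy f = energy g.
Proof.
move=> mf mg fg; apply: ae_eq_integral => //.
- by apply/measurable_EFinP; exact: measurable_enorm_sqr.
- by apply/measurable_EFinP; exact: measurable_enorm_sqr.
- by apply: filterS fg => x -> _.
Qed.

End L2sigma_facts.

(** * The support of a field on space-time *)
Section spacetime.
Context {R : realType} {n : nat}.
Local Notation Rn := 'rV[R]_n.
Local Notation time := (measurableTypeR R).
Local Notation mu := (@lebesgue_rV R n).
Local Notation st := (mu \x (@lebesgue_measure R))%E.

(** Open intervals with rational centre and half-width [1/(k+1)]. *)
Definition rat_interval (s : rat) (k : nat) : set R :=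
  [set t | `|t - ratr s| < k.+1%:R^-1].

Lemma measurable_rat_interval s k : measurable (rat_interval s k : set time).
Proof.
rewrite (_ : rat_interval s k = [set` `]ratr s - k.+1%:R^-1,
  ratr s + k.+1%:R^-1[ ]); first exact: measurable_itv.
by apply/funext => t; rewrite /rat_interval /= in_itv/= ltr_distl.
Qed.

Lemma rat_interval_nbhs (t : R) (A : set R) : nbhs t A ->
  exists s k, rat_interval s k t /\ rat_interval s k `<=` A.
Proof.
move=> /nbhs_ballP[d /= d0 dA].
have [k kd] : exists k : nat, k.+1%:R^-1 < d / 2.
  have := near_infty_natSinv_lt (PosNum (divr_gt0 d0 (ltr0Sn R 1))).
  by move=> [k _ /(_ k (leqnn k)) /= ?]; exists k.
have k0 : 0 < k.+1%:R^-1 :> R by rewrite invr_gt0.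
have [s ts] := rat_approx t k0; exists s, k; split=> // y ys; apply: dA.
rewrite /ball/=; have := ler_distD (ratr s) t y; rewrite (distrC (ratr s)) => h.
by apply: le_lt_trans h _; rewrite (splitr d) ltrD// (lt_trans _ kd).
Qed.

(** Products of a rational cube and a rational interval: a countable basis of
    space-time. *)
Definition cell (z : 'rV[rat]_n * nat * (rat * nat)) : set (Rn * time) :=
  rat_cube z.1.1 z.1.2 `*` rat_interval z.2.1 z.2.2.

Lemma measurable_cell z : measurable (cell z).
Proof.
by apply: measurableX; [exact: measurable_rat_cube|exact: measurable_rat_interval].
Qed.

Lemma cell_nbhs (p : Rn * R) (U : set (Rn * R)) : open U -> U p ->
  exists z, cell z p /\ cell z `<=` U.
Proof.
move=> oU Up; have := open_nbhs_nbhs (conj oU Up).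
move=> [[A B] /= [Ap Bp] ABU].
have [q [k [qp qA]]] := rat_cube_nbhs Ap.
have [s [l [sp sB]]] := rat_interval_nbhs Bp.
exists ((q, k), (s, l)); split; first by split.
by move=> y [/= y1 y2]; apply: ABU; split; [exact: qA|exact: sB].
Qed.

Lemma open_measurable_spacetime (U : set (Rn * R)) :
  open U -> measurable (U : set (Rn * time)).
Proof.
move=> oU; rewrite (_ : U = \bigcup_z
    (if pselect (cell z `<=` U) then cell z else set0)).
  apply: countable_bigcupT_measurable => [|z]; first exact: countableP.
  by case: pselect => [?|?]; [exact: measurable_cell|exact: measurable0].
apply/seteqP; split=> x; last by move=> [z _]; case: pselect => // zU /zU.
move=> Ux; have [z [zx zU]] := cell_nbhs oU Ux.
by exists z => //; case: pselect.
Qed.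

Lemma continuous_measurable_spacetime (f : Rn * R -> R) :
  continuous f -> measurable_fun [set: Rn * time] f.
Proof.
move=> /continuousP cf; apply: (measurability _ (RGenOpens.measurableE R)).
move=> _ [_ [a [b ->] <-]]; rewrite setTI.
by apply: open_measurable_spacetime; apply: cf; exact: interval_open.
Qed.

Lemma negligible_countable (T : countType) d (X : measurableType d)
    (m : {measure set X -> \bar R}) (F : T -> set X) :
  (forall z, m.-negligible (F z)) -> m.-negligible (\bigcup_z F z).
Proof.
move=> Fm; pose G k := if unpickle k is Some z then F z else set0.
apply: (@negligibleS _ _ _ _ (\bigcup_k G k)).
  by move=> x [z _ Fzx]; exists (pickle z) => //; rewrite /G pickleK.
apply: negligible_bigcup => k; rewrite /G; case: unpickle => [z|]; first exact: Fm.
exact: negligible_set0.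
Qed.

(** A field vanishes almost everywhere off its essential support; this is the
    Lindelof property, through the countable basis of cells. *)
Lemma ess_support_null (u : Rn -> R -> Rn) (tau : R) :
  ess_support u `<=` [set: Rn] `*` `[0, tau] ->
  {ae st, forall p : Rn * time, tau < p.2 -> 0 <= p.2 -> u p.1 p.2 = 0}.
Proof.
move=> su.
pose P z := {ae st, forall q : Rn * time, cell z q -> 0 <= q.2 -> u q.1 q.2 = 0}.
pose F z : set (Rn * time) := if pselect (P z) then
  ~` [set q : Rn * time | cell z q -> 0 <= q.2 -> u q.1 q.2 = 0] else set0.
apply: (@negligibleS _ _ _ _ (\bigcup_z F z)); last first.
  apply: negligible_countable => z; rewrite /F.
  by case: pselect => [Pz|?]; [exact: Pz|exact: negligible_set0].
move=> p /= /not_implyP[tp /not_implyP[p0 up]].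
have /not_andP[/(_ p0)//|] : ~ (0 <= p.2 /\ forall U : set (Rn * R), open U -> U p ->
    ~ {ae st, forall q : Rn * time, U q -> 0 <= q.2 -> u q.1 q.2 = 0}).
  move=> /su[_ /=]; rewrite in_itv/= => /andP[_].
  by rewrite leNgt tp.
move=> /existsNP[U /not_implyP[oU /not_implyP[Up /contrapT aeU]]].
have [z [zp zU]] := cell_nbhs oU Up.
exists z => //; rewrite /F; case: pselect => [_ /=|nP].
  by move=> /(_ zp p0).
exfalso; apply: nP; apply: filterS aeU => q qU zq; apply: qU; exact: zU.
Qed.

End spacetime.

(** * Momentum estimate for solutions of bounded lifetime *)
Section momentum.
Context {R : realType} {n : nat}.
Local Notation Rn := 'rV[R]_n.
Local Notation time := (measurableTypeR R).
Local Notation mu := (@lebesgue_rV R n).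
Local Notation st := (mu \x (@lebesgue_measure R))%E.
Variables (Phi : Rn * R -> Rn) (tPhi : test_function Phi).

(** The integrand [v . d_t Phi + v (x) v : D Phi] of the weak formulation. *)
Definition flux (v : Rn) (p : Rn * R) : R :=
  \sum_(i < n) v ord0 i * dtime Phi p ord0 i +
  \sum_(i < n) \sum_(j < n) v ord0 i * v ord0 j * dspace j Phi p ord0 i.

Lemma flux0 p : flux 0 p = 0.
Proof.
rewrite /flux !big1 ?addr0// => i _; last by rewrite mxE mul0r.
by rewrite big1// => j _; rewrite mxE !mul0r.
Qed.

Lemma measurable_flux (U : Rn * time -> Rn) : measurable_fun setT U ->
  measurable_fun setT (fun p : Rn * time => flux (U p) p).
Proof.
move=> /measurable_fun_rVP mU.
have mD v i : measurable_fun setT (fun p : Rn * time => 'D_v Phi p ord0 i).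
  apply: continuous_measurable_spacetime => p.
  apply: (@continuous_comp _ _ _ ('D_v Phi) (fun y : Rn => y ord0 i)).
    exact: (tPhi.1 [:: v]).1.
  exact: coord_continuous.
apply: measurable_funD.
  by apply: measurable_sum => i; apply: measurable_funM; [exact: mU|exact: mD].
apply: measurable_sum => i; apply: measurable_sum => j.
by apply: measurable_funM; [apply: measurable_funM; exact: mU|exact: mD].
Qed.

Variables (u0 : Rn -> Rn) (u : Rn -> R -> Rn) (tau : R).
Hypotheses (mu0 : measurable_fun setT u0) (u0oo : (energy u0 < +oo)%E).
Hypotheses (tau0 : 0 <= tau) (uadm : admissible_weak_solution u0 u).
Hypothesis usupp : ess_support u `<=` [set: Rn] `*` `[0, tau].

(* Only the values of [u] at nonnegative times are meaningful; [U] extends them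
   by 0, and [U'] moreover cuts them after time [tau].  The two agree almost
   everywhere by the hypothesis on the support. *)
Let U (p : Rn * time) : Rn := if 0 <= p.2 then u p.1 p.2 else 0.
Let U' (p : Rn * time) : Rn := if p.2 <= tau then U p else 0.

Let mle (c : R) : measurable_fun [set: Rn * time] (fun p : Rn * time => c <= p.2).
Proof. by apply: measurable_fun_ler => //; exact: measurable_snd. Qed.

Let mge (c : R) : measurable_fun [set: Rn * time] (fun p : Rn * time => p.2 <= c).
Proof. by apply: measurable_fun_ler => //; exact: measurable_snd. Qed.

Let mU : measurable_fun setT U.
Proof.
apply: measurable_fun_if => //.
rewrite setTI (_ : _ @^-1` _ = [set p : Rn * time | 0 <= p.2]).
  by have [[]] := uadm.
by apply/seteqP; split=> p.
Qed.

Let mU' : measurable_fun setT U'.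
Proof. by apply: measurable_fun_ifT. Qed.

Let UU' : {ae st, forall p, U p = U' p}.
Proof.
apply: filterS (ess_support_null usupp) => p; rewrite /U' /U.
by case: leP => // tp /(_ isT); case: ifP => // p0 /(_ isT).
Qed.

Variables (a b M : R).
Hypotheses (a0 : 0 <= a) (b0 : 0 <= b).
Hypothesis flux_le : forall v p,
  `|flux v p| <= a * enorm v ^+ 2 + b * \1_(cube M) p.1.

Let K := a * fine (energy u0) + b * fine (mu (cube M)).

(* This is where the energy inequality is used, at every time of [[0, tau]]. *)
Let flux_slice (t : R) :
  (\int[mu]_x `|(flux (U' (x, t)) (x, t))%:E| <= (K * \1_`[0%R, tau] t)%:E)%E.
Proof.
rewrite /U' /U /= indicE mem_setE in_itv/=.
have [t0|t0] := leP 0 t; last first.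
  rewrite mulr0 integral0_eq// => x _.
  by rewrite /= if_same flux0 normr0.
have [tt|tt] := leP t tau; last first.
  by rewrite mulr0 integral0_eq// => x _; rewrite flux0 normr0.
have mut : measurable_fun setT (u ^~ t).
  have : measurable_fun setT (fun x => U (x, t)).
    by apply: (measurableT_comp mU); exact: pair2_measurable.
  by apply: eq_measurable_fun => x _; rewrite /U /= t0.
rewrite mulr1.
have mcube : measurable_fun setT (fun x : Rn => \1_(cube M) x : R).
  by apply: measurable_indic; exact: measurable_cube_sym.
have menorm := measurable_enorm_sqr mut.
have mflux : measurable_fun setT (fun x => flux (u x t) (x, t)).
  have : measurable_fun setT (fun x => flux (U (x, t)) (x, t)).
    by apply: (measurableT_comp (measurable_flux mU)); exact: pair2_measurable.
  by apply: eq_measurable_fun => x _; rewrite /U /= t0.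
apply: (@le_trans _ _ (\int[mu]_x
    (a%:E * (enorm (u x t) ^+ 2)%:E + b%:E * (\1_(cube M) x)%:E)%E)%E).
  apply: ge0_le_integral => //.
  - by apply/measurable_EFinP; exact: measurableT_comp.
  - apply: emeasurable_funD; apply/measurable_EFinP; exact: measurable_funM.
  - by move=> x _; rewrite -!EFinM -EFinD lee_fin; exact: flux_le.
rewrite ge0_integralD//; first last.
- by apply/measurable_EFinP; exact: measurable_funM.
- by move=> x _; rewrite mule_ge0// lee_fin.
- by apply/measurable_EFinP; exact: measurable_funM.
- by move=> x _; rewrite mule_ge0// lee_fin sqr_ge0.
have mab (k : R) (h : Rn -> R) : 0 <= k -> (forall x, 0 <= h x) ->
    measurable_fun setT h ->
    (\int[mu]_x (k%:E * (h x)%:E) = k%:E * \int[mu]_x (h x)%:E)%E.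
  move=> k0 h0 mh; apply: ge0_integralZl_EFin => //; last exact/measurable_EFinP.
  by move=> x _; rewrite lee_fin.
rewrite (mab a (fun x => enorm (u x t) ^+ 2))//; last by move=> x; exact: sqr_ge0.
rewrite (mab b)//.
rewrite integral_indic ?setIT//; last exact: measurable_cube_sym.
rewrite /K EFinD !EFinM energyK// fineK; last first.
  by rewrite ge0_fin_numE// cube_fin.
rewrite leeD2r// lee_pmul//; first exact: energy_ge0.
by have [_ _] := uadm; apply.
Qed.

Let K0 : 0 <= K.
Proof. by rewrite addr_ge0// mulr_ge0// ?fine_energy_ge0// fine_ge0. Qed.

Let flux_total :
  (\int[lebesgue_measure]_t \int[mu]_x `|(flux (U' (x, t)) (x, t))%:E|
    <= (tau * K)%:E)%E.
Proof.
have mF : measurable_fun setT (fun p : Rn * time => `|(flux (U' p) p)%:E|%E).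
  by apply/measurableT_comp => //; apply/measurable_EFinP; exact: measurable_flux.
apply: (@le_trans _ _ (\int[lebesgue_measure]_t (K * \1_`[0%R, tau] t)%:E)%E).
  apply: ge0_le_integral => //.
  - by move=> t _; exact: integral_ge0.
  - exact: (measurable_fun_fubini_tonelli_G _ mF).
  - by apply/measurable_EFinP/measurable_funM => //; exact: measurable_indic.
under eq_integral do rewrite EFinM.
rewrite ge0_integralZl_EFin//; last first.
  by apply/measurable_EFinP; exact: measurable_indic.
rewrite integral_indic// setIT/= lebesgue_measure_itv/= lte_fin.
case: ifPn => t0; last by rewrite mule0 lee_fin mulr_ge0.
by rewrite -EFinB subr0 -EFinM mulrC.
Qed.

(** Fubini's theorem turns the weak formulation into an integral over
    space-time, where [U] can be replaced with [U']. *)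
Lemma momentum_bound : (energy (fun x => Phi (x, 0%R)) < +oo)%E ->
  (forall x t, 0 <= t -> \sum_(j < n) dspace j Phi (x, t) ord0 j = 0) ->
  `|pairing u0 (fun x => Phi (x, 0))| <= tau * K.
Proof.
move=> Phioo Phidiv.
have mPhi : measurable_fun setT (fun x => Phi (x, 0)).
  apply: continuous_measurable_field => x.
  apply: (@continuous_comp _ _ _ (fun x : Rn => (x, 0 : R)) Phi).
    exact: continuous_pair_cst.
  exact: (tPhi.1 [::]).1.
have mf := measurable_flux mU; have mf' := measurable_flux mU'.
pose f (p : Rn * time) : \bar R := (flux (U p) p)%:E.
pose f' (p : Rn * time) : \bar R := (flux (U' p) p)%:E.
have Mf : measurable_fun setT f by exact/measurable_EFinP.
have Mf' : measurable_fun setT f' by exact/measurable_EFinP.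
have ff' : {ae st, forall p, setT p -> f p = f' p}.
  by apply: filterS UU' => p Up _; rewrite /f /f' Up.
have if' : st.-integrable setT f'.
  by apply/integrable21ltyP => //; rewrite (le_lt_trans flux_total)// ltry.
have iff : st.-integrable setT f.
  apply/integrableP; split=> //; have /integrableP[_] := if'; apply: le_lt_trans.
  rewrite le_eqVlt; apply/orP; left; apply/eqP; apply: ae_eq_integral => //.
  - exact: measurableT_comp.
  - exact: measurableT_comp.
  - by apply: filterS ff' => p /(_ I) h _; exact: (congr1 abse h).
have E : (\int[lebesgue_measure]_(t in `[0%R, +oo[) \int[mu]_x
     (\sum_(i < n) u x t ord0 i * dtime Phi (x, t) ord0 i +
      \sum_(i < n) \sum_(j < n)
        u x t ord0 i * u x t ord0 j * dspace j Phi (x, t) ord0 i)%:E)%E =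
    (\int[st]_p f p)%E.
  rewrite -(integral21_prod_meas1 iff) integral_mkcond.
  apply: eq_integral => t _; rewrite patchE mem_setE in_itv/= andbT /fubini_G.
  have [t0|t0] := leP 0 t.
    by apply: eq_integral => x _; rewrite /f /U /= t0.
  by rewrite integral0_eq// => x _; rewrite /f /U /= leNgt t0 flux0.
have [_ ws _] := uadm; have := ws Phi tPhi Phidiv; rewrite E.
have -> : (\int[mu]_x (\sum_(i < n) u0 x ord0 i * Phi (x, 0) ord0 i)%:E =
    (pairing u0 (fun x => Phi (x, 0)))%:E)%E by rewrite pairingE.
have ffin := integrable_fin_num measurableT iff.
rewrite -(fineK ffin) -EFinD => -[/eqP]; rewrite addr_eq0 => /eqP /(congr1 Num.norm).
rewrite normrN => <-; rewrite -lee_fin -abse_EFin fineK//.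
rewrite (ae_eq_integral f')//.
rewrite (le_trans (le_abse_integral _ _ _))//.
rewrite (le_trans _ flux_total)//.
rewrite (fubini_tonelli2 (abse \o f'))//; first exact: measurableT_comp.
by move=> p; exact: abse_ge0.
Qed.

End momentum.

(** * Rescaled test fields *)
Section probe.
Context {R : realType} {n : nat}.
Local Notation Rn := 'rV[R]_n.
Local Notation mu := (@lebesgue_rV R n).

(** The weight [t] balances the quadratic term against the volume of the
    support of the field. *)
Lemma flux_bound (Phi : Rn * R -> Rn) (A M t : R) : 0 < t -> 0 <= A ->
  (forall p i, `|dtime Phi p ord0 i| <= A) ->
  (forall p i j, `|dspace j Phi p ord0 i| <= A) ->
  (forall p, dtime Phi p != 0 -> cube M p.1) ->
  forall v p, `|flux Phi v p| <=
    A * (t + n%:R) * enorm v ^+ 2 + A * n%:R * t^-1 * \1_(cube M) p.1.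
Proof.
move=> t0 A0 dt ds dtM v p; have ti : 0 < t^-1 by rewrite invr_gt0.
have h1 : `|\sum_(i < n) v ord0 i * dtime Phi p ord0 i| <=
    A * t * enorm v ^+ 2 + A * n%:R * t^-1 * \1_(cube M) p.1.
  have [d0|/dtM pM] := eqVneq (dtime Phi p) 0.
    rewrite big1 ?normr0; last by move=> i _; rewrite d0 mxE mulr0.
    apply: addr_ge0.
      by apply: mulr_ge0; [apply: mulr_ge0 => //; exact: ltW|exact: sqr_ge0].
    rewrite indicE; apply: mulr_ge0 => //; apply: mulr_ge0; last exact: ltW.
    exact: mulr_ge0.
  rewrite indicE mem_set// mulr1 (le_trans (ler_norm_sum _ _ _))//.
  apply: (@le_trans _ _ (\sum_(i < n) (A * t * v ord0 i ^+ 2 + A * t^-1))).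
    apply: ler_sum => i _; rewrite normrM.
    apply: (@le_trans _ _ (`|v ord0 i| * A)); first by rewrite ler_wpM2l.
    rewrite mulrC -!mulrA -mulrDr ler_wpM2l// -subr_ge0.
    rewrite -(@real_normK _ (v ord0 i)) ?num_real//.
    move: `|v ord0 i| (normr_ge0 (v ord0 i)) => x x0.
    have -> : t * x ^+ 2 + t^-1 - x = t^-1 * ((t * x - 2^-1) ^+ 2 + 3 / 4).
      by field; rewrite gt_eqF.
    by rewrite mulr_ge0 ?addr_ge0 ?sqr_ge0// ltW.
  rewrite big_split/= -mulr_sumr -enorm_sqr sumr_const card_ord -mulr_natr.
  by rewrite le_eqVlt; apply/orP; left; apply/eqP; ring.
have h2 : `|\sum_(i < n) \sum_(j < n)
    v ord0 i * v ord0 j * dspace j Phi p ord0 i| <= A * n%:R * enorm v ^+ 2.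
  apply: (@le_trans _ _ (\sum_(i < n) \sum_(j < n)
      (A / 2 * v ord0 i ^+ 2 + A / 2 * v ord0 j ^+ 2))).
    rewrite (le_trans (ler_norm_sum _ _ _))//; apply: ler_sum => i _.
    rewrite (le_trans (ler_norm_sum _ _ _))//; apply: ler_sum => j _.
    rewrite !normrM; apply: (@le_trans _ _ (`|v ord0 i| * `|v ord0 j| * A)).
      by rewrite ler_wpM2l// mulr_ge0.
    rewrite -(@real_normK _ (v ord0 i)) ?num_real//.
    rewrite -(@real_normK _ (v ord0 j)) ?num_real//.
    rewrite -subr_ge0; move: `|v ord0 i| `|v ord0 j| => x y.
    have -> : A / 2 * x ^+ 2 + A / 2 * y ^+ 2 - x * y * A = A / 2 * (x - y) ^+ 2.
      by field.
    by rewrite mulr_ge0 ?sqr_ge0// divr_ge0.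
  under eq_bigr do rewrite big_split/= sumr_const card_ord -mulr_sumr -enorm_sqr.
  rewrite big_split/= sumr_const card_ord sumrMnl -mulr_sumr -enorm_sqr.
  rewrite -[X in X + _]mulr_natr -[X in _ + X]mulr_natr.
  rewrite le_eqVlt; apply/orP; left; apply/eqP.
  by field.
rewrite /flux (le_trans (ler_normD _ _))// (le_trans (lerD h1 h2))//.
by rewrite le_eqVlt; apply/orP; left; apply/eqP; ring.
Qed.

(** The value at time 0 of a divergence-free test field is an admissible
    direction of perturbation. *)
Lemma weak_div_free_slice (Phi : Rn * R -> Rn) M : test_function Phi ->
  (forall p, \sum_(j < n) dspace j Phi p ord0 j = 0) ->
  (forall x, Phi (x, 0) != 0 -> cube M x) ->
  weak_div_free (fun x => Phi (x, 0)).
Proof.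
move=> [sPhi _] div0 PhiM.
have c0 : continuous (fun x : Rn => (x, 0 : R)) by exact: continuous_pair_cst.
apply: (@div_free_weak _ _ _ (fun i x => dspace i Phi (x, 0) ord0 i) M) => //.
- move=> x; apply: (@continuous_comp _ _ _ (fun x : Rn => (x, 0 : R)) Phi) => //.
    exact: c0.
  exact: (sPhi [::]).1.
- move=> i x; apply: (@continuous_comp _ _ _ (fun x : Rn => (x, 0 : R))
    (fun p => dspace i Phi p ord0 i)); first exact: c0.
  apply: (@continuous_comp _ _ _ (dspace i Phi) (fun y : Rn => y ord0 i)).
    exact: (sPhi [:: _]).1.
  exact: coord_continuous.
- move=> i x.
  apply: (@is_derive_along R _ _ (fun p => Phi p ord0 i) (fun x : Rn => (x, 0 : R))
    _ _ (delta_mx ord0 i, 0)).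
    by move=> h; congr pair; rewrite /= /GRing.scale/= mulr0 add0r.
  have dPhi := (sPhi [::]).2 (x, 0) (delta_mx ord0 i, 0).
  rewrite /dspace derive_mx// mxE; apply: derivableP.
  by move/derivable_mxP : dPhi.
Qed.

End probe.

Section probe_field.
Context {R : realType} {n : nat}.
Local Notation Rn := 'rV[R]_n.
Local Notation mu := (@lebesgue_rV R n).

(** The field [phi] is the slice at time 0 of the test field rescaled by
    [e = k^2].  The parameter is [k] and not [e] so that [sqrt (e^n)] is the
    integer power [k^n]. *)
Lemma probe_field : (2 <= n)%N -> exists C N0 N1 : R,
  [/\ 0 < C, 0 < N0 & 0 < N1] /\
  forall k : R, 0 < k -> k <= 1 -> exists phi : Rn -> Rn,
  [/\ measurable_fun setT phi, (energy phi < +oo)%E,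
      N0 * (k ^- n) ^+ 2 <= fine (energy phi) <= N1 * (k ^- n) ^+ 2,
      weak_div_free phi &
      forall (u0 : Rn -> Rn) (u : Rn -> R -> Rn) (tau : R),
        measurable_fun setT u0 -> (energy u0 < +oo)%E -> 0 <= tau ->
        admissible_weak_solution u0 u ->
        ess_support u `<=` [set: Rn] `*` `[0, tau] ->
        `|pairing u0 phi| <= tau * (k ^+ 2 * C * k ^- n * (fine (energy u0) + 1))].
Proof.
move=> n2; have [C [c [a [b [[C0 c0 ab] HPhi]]]]] := @test_field_scaled R n n2.
have n0 : 0 < n%:R :> R by rewrite ltr0n (ltn_trans _ n2).
exists (C * (1 + n%:R + n%:R * 2 ^+ n)), (c * (b - a) ^+ n),
  (n%:R * C ^+ 2 * 2 ^+ n); split.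
  split.
  - by rewrite mulr_gt0// !addr_gt0// mulr_gt0// exprn_gt0.
  - by rewrite mulr_gt0// exprn_gt0// subr_gt0.
  - by rewrite !mulr_gt0// exprn_gt0.
move=> k k0 k1; have e0 : 0 < k ^+ 2 by rewrite exprn_gt0.
have [Phi [tPhi div0 Phiout [PhiC dtC dsC Phic]]] := HPhi _ e0.
pose M := (k ^+ 2)^-1; pose Q := k ^- n.
have M0 : 0 < M by rewrite invr_gt0.
have Q1 : 1 <= Q by rewrite invr_ge1 ?exprn_ile1 ?unitfE ?gt_eqF ?exprn_gt0// ltW.
have Q0 : 0 < Q by exact: lt_le_trans Q1.
have MQ : M ^+ n = Q ^+ 2 by rewrite /M /Q -exprVn -exprM -exprVn -exprM mulnC.
have out (p : Rn * R) : (forall i, `|p.1 ord0 i| < M) \/ (Phi p = 0 /\ dtime Phi p = 0).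
  have [/existsP[i pi]|/existsPn pM] := boolP [exists i, M <= `|p.1 ord0 i|].
    by right; apply: Phiout; exists i.
  by left => i; rewrite ltNge; exact: pM.
have inM (p : Rn * R) : (forall i, `|p.1 ord0 i| < M) -> cube M p.1.
  by move=> pM i; rewrite in_itv/= -ler_norml ltW.
have dtM (p : Rn * R) : dtime Phi p != 0 -> cube M p.1.
  by case: (out p) => [/inM//|[_ ->]]; rewrite eqxx.
have PhiM (x : Rn) : Phi (x, 0) != 0 -> cube M x.
  by case: (out (x, 0)) => [/inM//|[-> _]]; rewrite eqxx.
pose phi (x : Rn) : Rn := Phi (x, 0).
have cphi : continuous phi.
  move=> x; apply: (@continuous_comp _ _ _ (fun x : Rn => (x, 0 : R)) Phi).
    exact: continuous_pair_cst.
  exact: (tPhi.1 [::]).1.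
have mphi := continuous_measurable_field cphi.
have phioo : (energy phi < +oo)%E by exact: (energy_fin_cube cphi PhiM).
have mucube : mu (cube M) = (2 ^+ n * Q ^+ 2)%:E.
  rewrite lebesgue_rV_cube; last by rewrite (le_trans _ (ltW M0))// oppr_le0 ltW.
  by congr EFin; rewrite -MQ -exprMn; congr (_ ^+ n); ring.
have mind (A : set Rn) : measurable A -> measurable_fun setT (fun x : Rn => \1_A x : R).
  by move=> mA; exact: measurable_indic.
have intind (r : R) (A : set Rn) : 0 <= r -> measurable A ->
    (\int[mu]_x (r * \1_A x)%:E = r%:E * mu A)%E.
  move=> r0 mA; under eq_integral do rewrite EFinM.
  rewrite ge0_integralZl_EFin//; last by apply/measurable_EFinP; exact: mind.
  by rewrite integral_indic// setIT.
exists phi; split => //.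
- have menorm : measurable_fun setT (fun x => (enorm (phi x) ^+ 2)%:E).
    by apply/measurable_EFinP; exact: measurable_enorm_sqr.
  rewrite -!lee_fin energyK//; apply/andP; split.
    pose A : set Rn := [set x | forall j, x ord0 j \in `[M * a, M * b]].
    have mA : measurable A.
      apply: (@measurable_cube _ _ (fun=> `[M * a, M * b]%classic)) => _.
      exact: measurable_itv.
    have -> : (c * (b - a) ^+ n * Q ^+ 2)%:E = (\int[mu]_x (c * \1_A x)%:E)%E.
      rewrite intind ?ltW// lebesgue_rV_cube; last by rewrite ler_pM2l// ltW.
      by rewrite -EFinM -mulrBr exprMn MQ; congr EFin; ring.
    apply: ge0_le_integral => //.
    + by move=> x _; rewrite lee_fin mulr_ge0// ltW.
    + by apply/measurable_EFinP; apply: measurable_funM => //; exact: mind.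
    + move=> x _; rewrite lee_fin indicE; case: (boolP (x \in A)) => [|_].
        rewrite inE mulr1 => Ax; rewrite enorm_sqr; apply: Phic => i.
        by have := Ax i; rewrite in_itv.
      by rewrite mulr0 sqr_ge0.
  have -> : (n%:R * C ^+ 2 * 2 ^+ n * Q ^+ 2)%:E =
      (\int[mu]_x (n%:R * C ^+ 2 * \1_(cube M) x)%:E)%E.
    rewrite intind ?mucube//; [|by rewrite mulr_ge0// ltW// exprn_gt0|
      exact: measurable_cube_sym].
    by rewrite -EFinM; congr EFin; ring.
  apply: ge0_le_integral => //.
  + by move=> x _; rewrite lee_fin sqr_ge0.
  + apply/measurable_EFinP; apply: measurable_funM => //.
    exact: (mind _ (measurable_cube_sym M)).
  + move=> x _; rewrite lee_fin.
    have [px0|/PhiM xM] := eqVneq (phi x) 0.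
      rewrite px0 enorm_sqr big1; last by move=> i _; rewrite mxE expr0n.
      by rewrite indicE mulr_ge0// mulr_ge0// exprn_ge0// ltW.
    rewrite indicE mem_set// mulr1 enorm_sqr.
    have -> : n%:R * C ^+ 2 = \sum_(i < n) C ^+ 2.
      by rewrite sumr_const card_ord mulr_natl.
    apply: ler_sum => i _; rewrite -[leLHS]real_normK ?num_real//.
    by rewrite lerXn2r ?nnegrE ?(ltW C0)//; exact: PhiC.
- exact: (weak_div_free_slice tPhi div0 PhiM).
- move=> u0 u tau mu0 u0oo tau0 uadm usupp.
  have A0 : 0 <= k ^+ 2 * C by rewrite mulr_ge0 ?ltW.
  have fb := flux_bound Q0 A0 dtC dsC dtM.
  have h1 : 0 <= k ^+ 2 * C * (Q + n%:R) by rewrite mulr_ge0// addr_ge0// ltW.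
  have h2 : 0 <= k ^+ 2 * C * n%:R * Q^-1.
    by apply: mulr_ge0; [exact: mulr_ge0|rewrite invr_ge0 ltW].
  have := momentum_bound tPhi mu0 u0oo tau0 uadm usupp h1 h2 fb phioo
    (fun x t _ => div0 (x, t)).
  move=> /le_trans; apply; rewrite ler_wpM2l// mucube/=.
  have E0 := fine_energy_ge0 u0.
  have -> : k ^+ 2 * C * n%:R * Q^-1 * (2 ^+ n * Q ^+ 2) =
      k ^+ 2 * C * (n%:R * 2 ^+ n * Q) by field; rewrite gt_eqF.
  rewrite -/Q; set E := fine _ in E0 *.
  rewrite -[X in X + _ <= _]mulrA -mulrDr.
  rewrite -![X in _ <= X]mulrA ![X in _ <= X]mulrA.
  have -> : k ^+ 2 * (C * (1 + n%:R + n%:R * 2 ^+ n)) * Q * (E + 1) =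
     k ^+ 2 * C * ((1 + n%:R + n%:R * 2 ^+ n) * Q * (E + 1)) by ring.
  rewrite ler_wpM2l// -subr_ge0.
  set m := 2 ^+ n; have m0 : 0 <= m by rewrite exprn_ge0.
  have -> : (1 + n%:R + n%:R * m) * Q * (E + 1) - ((Q + n%:R) * E + n%:R * m * Q) =
    n%:R * E * (Q - 1) + (Q + n%:R * Q) + n%:R * m * Q * E by ring.
  by rewrite !addr_ge0 ?mulr_ge0 ?subr_ge0// ltW.
Qed.

End probe_field.

(** * Density is impossible in any ball *)
Section perturbation.
Context {R : realType} {n : nat}.
Local Notation Rn := 'rV[R]_n.
Local Notation mu := (@lebesgue_rV R n).

Lemma weak_div_freeD (f g : Rn -> Rn) (s : R) :
  measurable_fun setT f -> measurable_fun setT g ->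
  (energy f < +oo)%E -> (energy g < +oo)%E ->
  weak_div_free f -> weak_div_free g -> weak_div_free (fun x => f x + s *: g x).
Proof.
move=> mf mg foo goo df dg.
have msg := measurable_scalerV s mg.
have sgoo : (energy (fun x => (s *: g x)%R) < +oo)%E.
  by rewrite energyZ// -(energyK goo) -EFinM ltry.
apply/weak_div_freeP; first exact: measurable_addrV.
  rewrite (le_lt_trans (energyD_le mf msg))// -(energyK foo) -(energyK sgoo).
  by rewrite -!EFinM -EFinD ltry.
move=> psi tpsi.
have mgr := continuous_measurable_field (continuous_grad tpsi).
have gr := energy_grad_fin tpsi.
rewrite pairingD// pairingZ//.
by rewrite (weak_div_freeP mf foo).1// (weak_div_freeP mg goo).1// mulr0 addr0.
Qed.

Lemma L2sigma_translate (v : @L2sigma R n) (g : Rn -> Rn) (s : R) :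
  measurable_fun setT g -> (energy g < +oo)%E -> weak_div_free g ->
  exists w : @L2sigma R n,
    {ae mu, forall x, w x = v x + s *: g x}.
Proof.
move=> mg goo dg; have mv := measurable_L2sigma v.
have voo := L2sigma_energy v.
have msg := measurable_scalerV s mg.
apply: L2sigma_of.
- exact: measurable_addrV.
- rewrite (le_lt_trans (energyD_le mv msg))// energyZ// -(energyK voo) -(energyK goo).
  by rewrite -!EFinM -EFinD ltry.
- by apply: weak_div_freeD => //; exact: L2sigma_div.
Qed.

Lemma pairing_ae (f g h : Rn -> Rn) : measurable_fun setT f ->
  measurable_fun setT g -> measurable_fun setT h ->
  {ae mu, forall x, f x = g x} -> pairing f h = pairing g h.
Proof.
move=> mf mg mh fg; congr fine; apply: ae_eq_integral => //.
- by apply/measurable_EFinP; exact: measurable_dot.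
- by apply/measurable_EFinP; exact: measurable_dot.
- by apply: filterS fg => x -> _.
Qed.

Lemma fine_energyD_le (f g : Rn -> Rn) : measurable_fun setT f ->
  measurable_fun setT g -> (energy f < +oo)%E -> (energy g < +oo)%E ->
  fine (energy (fun x => f x + g x)) <= 2 * fine (energy f) + 2 * fine (energy g).
Proof.
move=> mf mg foo goo; have h := energyD_le mf mg.
have fgoo : (energy (fun x => f x + g x)%R < +oo)%E.
  by rewrite (le_lt_trans h)// -(energyK foo) -(energyK goo) -!EFinM -EFinD ltry.
by rewrite -lee_fin energyK// EFinD !EFinM !energyK.
Qed.

End perturbation.

Lemma le_norm_add_sign (R : realDomainType) (p q : R) : 0 <= q ->
  q <= `|p + (if 0 <= p then q else - q)|.
Proof.
move=> q0; case: (leP 0 p) => p0; first by rewrite ger0_norm ?addr_ge0// lerDr.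
by rewrite -normrN opprD opprK ger0_norm ?addr_ge0 ?lerDr// oppr_ge0 ltW.
Qed.

Theorem corollaryF (R : realType) (n : nat) (tau : R)
  (hn : (2 <= n)%N) (htau : 0 < tau) :
  nowhere_dense [set u0 : @L2sigma R n | exists u : 'rV[R]_n -> R -> 'rV[R]_n,
    admissible_weak_solution u0 u /\
    ess_support u `<=` [set: 'rV[R]_n] `*` `[0, tau]].
Proof.
apply/seteqP; split=> // v; set A := [set u0 | _].
move=> /nbhs_ballP[r /= r0 rA].
have [C [N0 [N1 [[C0 N00 N10] probe]]]] := @probe_field R n hn.
pose mL2 := @measurable_L2sigma R n; pose eL2 := @L2sigma_energy R n.
have [sigma s0 sN1] : exists2 sigma, 0 < sigma & sigma ^+ 2 * N1 < r ^+ 2.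
  exists (r / (N1 + 1)); first by rewrite divr_gt0// addr_gt0.
  rewrite expr_div_n mulrAC ltr_pdivrMr ?exprn_gt0 ?addr_gt0//.
  by rewrite ltr_pM2l ?exprn_gt0//; nra.
pose c := sigma * N0; have c0 : 0 < c by rewrite mulr_gt0.
(* [theta * delta ^+ 2] and [N1 / theta] both equal [c / 2]: these are the two
   terms of the weighted Cauchy-Schwarz inequality for an error of size [delta] *)
pose theta := 2 * N1 / c; have t0 : 0 < theta by rewrite divr_gt0// mulr_gt0.
pose delta := Num.sqrt (c / (2 * theta)).
have d0 : 0 < delta by rewrite sqrtr_gt0 divr_gt0// mulr_gt0.
have d2 : delta ^+ 2 = c / (2 * theta).
  by rewrite sqr_sqrtr// ltW// divr_gt0// mulr_gt0.
pose E0 := 2 * (2 * fine (energy v) + 2 * r ^+ 2) + 2 * delta ^+ 2.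
have E00 : 0 <= E0.
  have := fine_energy_ge0 v; have := sqr_ge0 r; have := sqr_ge0 delta.
  by rewrite /E0; lra.
pose D := tau * (C * (E0 + 1)).
have D0 : 0 < D by rewrite !mulr_gt0// ltr_wpDl.
(* this value of [k] makes [k ^+ 2 * D < c / 2] *)
pose k := c / (c + 4 * D).
have cD : 0 < c + 4 * D by rewrite addr_gt0// mulr_gt0.
have k0 : 0 < k by rewrite divr_gt0.
have k1 : k <= 1 by rewrite ler_pdivrMr// mul1r lerDl mulr_ge0// ltW.
have [phi [mphi phioo /andP[Nphi phiN] dphi bphi]] := probe k k0 k1.
set Q := k ^- n in Nphi phiN bphi.
have kn0 : 0 < k ^+ n by rewrite exprn_gt0.
have Q0 : 0 < Q by rewrite invr_gt0.
have QK : k ^+ n * Q = 1 by rewrite divff// gt_eqF.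
(* the sign makes the two contributions to the pairing add up *)
pose s := (if 0 <= pairing v phi then sigma else - sigma) * k ^+ n.
have s2 : s ^+ 2 = sigma ^+ 2 * (k ^+ n) ^+ 2.
  by rewrite /s exprMn; case: ifP => _; rewrite ?sqrrN.
have [w wE] := L2sigma_translate v s mphi phioo dphi.
have msphi := measurable_scalerV s mphi.
have sphioo : (energy (fun x => (s *: phi x)%R) < +oo)%E.
  by rewrite energyZ// -(energyK phioo) -EFinM ltry.
have esphi : fine (energy (fun x => (s *: phi x)%R)) < r ^+ 2.
  rewrite energyZ// -(energyK phioo) -EFinM/= s2.
  apply: le_lt_trans sN1; rewrite -mulrA ler_wpM2l ?sqr_ge0//.
  apply: (@le_trans _ _ ((k ^+ n) ^+ 2 * (N1 * Q ^+ 2))).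
    by rewrite ler_wpM2l ?sqr_ge0.
  by rewrite mulrCA -exprMn QK expr1n mulr1.
have vw : ball v r w.
  apply/ball_energy => //.
  rewrite (@energy_ae _ _ _ (fun x => (- s) *: phi x)).
  - by rewrite energyZ// sqrrN -energyZ.
  - by apply: measurable_subrV; exact: mL2.
  - exact: measurable_scalerV.
  - by apply: filterS wE => x ->; rewrite opprD addNKr scaleNr.
have [z [[u [uadm usupp]] wz]] := rA w vw (ball w delta) (nbhsx_ballx w delta d0).
have mzw : measurable_fun setT (fun x => z x - w x).
  by apply: measurable_subrV; exact: mL2.
have ezw : fine (energy (fun x => z x - w x)) < delta ^+ 2.
  by apply/ball_energy => //; exact: ball_sym.
have zwoo : (energy (fun x => (z x - w x)%R) < +oo)%E.
  by apply: energyB_fin; [exact: mL2|exact: mL2|exact: eL2|exact: eL2].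
have ew : fine (energy w) <= 2 * fine (energy v) + 2 * r ^+ 2.
  rewrite (energy_ae (mL2 w) (measurable_addrV (mL2 v) msphi) wE).
  rewrite (le_trans (fine_energyD_le (mL2 v) msphi (eL2 v) sphioo))//.
  by rewrite lerD2l ler_pM2l// ltW.
have ez : fine (energy z) <= E0.
  have -> : energy z = energy (fun x => w x + (z x - w x)).
    by apply: eq_integral => x _; rewrite addrC subrK.
  rewrite (le_trans (fine_energyD_le (mL2 w) mzw (eL2 w) zwoo))//.
  by rewrite /E0 lerD// ler_pM2l// ltW.
have pw : c * Q <= `|pairing w phi|.
  rewrite (pairing_ae (mL2 w) (measurable_addrV (mL2 v) msphi) mphi wE).
  rewrite (pairingD (mL2 v) msphi mphi (eL2 v) sphioo phioo).
  rewrite (pairingZ s mphi mphi phioo phioo) pairing_self.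
  have h : c * Q <= sigma * (k ^+ n * fine (energy phi)).
    rewrite /c -[leLHS]mulrA ler_pM2l//.
    apply: (@le_trans _ _ (k ^+ n * (N0 * Q ^+ 2))); last by rewrite ler_pM2l.
    have -> : k ^+ n * (N0 * Q ^+ 2) = N0 * (k ^+ n * Q) * Q by ring.
    by rewrite QK mulr1.
  rewrite /s -(mulrA _ (k ^+ n)).
  have -> (q : R) : (if 0 <= pairing v phi then sigma else - sigma) * q =
      if 0 <= pairing v phi then sigma * q else - (sigma * q).
    by case: ifP; rewrite ?mulNr.
  by rewrite (le_trans h)// le_norm_add_sign// (le_trans _ h)// ltW// mulr_gt0.
have pzw : `|pairing (fun x => z x - w x) phi| <= c / 2 * Q.
  have tQ : 0 < theta * Q by rewrite mulr_gt0.
  rewrite (le_trans (pairing_le tQ mzw mphi zwoo phioo))//.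
  rewrite ler_pdivrMr//.
  apply: (@le_trans _ _ (theta * Q * delta ^+ 2 + (theta * Q)^-1 * (N1 * Q ^+ 2))).
    rewrite lerD// ler_pM2l ?invr_gt0//; exact: ltW.
  rewrite d2 le_eqVlt; apply/orP; left; apply/eqP.
  by rewrite /theta; field; rewrite !gt_eqF.
have pz : c / 2 * Q <= `|pairing z phi|.
  have -> : pairing z phi = pairing w phi + pairing (fun x => z x - w x) phi.
    rewrite -(pairingD (mL2 w) mzw mphi (eL2 w) zwoo phioo).
    by apply: eq_Rintegral => x _; rewrite (addrC (w x)) subrK.
  apply: le_trans (lerB_normD _ _).
  apply: le_trans (lerB pw pzw).
  by rewrite -mulrBl [X in _ <= (X - _) * _](splitr c) addrK.
have := bphi z u tau (mL2 z) (eL2 z) (ltW htau) uadm usupp.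
move=> /(le_trans pz) h.
have : c / 2 * Q <= k ^+ 2 * D * Q.
  apply: (le_trans h).
  have -> : k ^+ 2 * D * Q = tau * (k ^+ 2 * C * Q * (E0 + 1)) by rewrite /D; ring.
  rewrite ler_pM2l// ler_pM2l; first by rewrite lerD2r.
  by apply: mulr_gt0 => //; apply: mulr_gt0 => //; rewrite exprn_gt0.
rewrite ler_pM2r// leNgt => /negP; apply.
have kk : k ^+ 2 <= k by rewrite expr2 ger_pMr.
apply: (@le_lt_trans _ _ (k * D)); first by rewrite ler_pM2r.
rewrite /k mulrAC ltr_pdivrMr// -subr_gt0.
have -> : c / 2 * (c + 4 * D) - c * D = c * D + c ^+ 2 / 2 by field.
apply: addr_gt0; first exact: mulr_gt0.
by apply: divr_gt0 => //; rewrite exprn_gt0.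
Qed.
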